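(* Let $d=2$ and let $f\in L^2(\Omega)$. Assume the stability hypothesis $C_{\mathrm{stab}}(k)<\infty$ and the mesh-size condition $H\le A_{\min}^{1/2}/(\sqrt2\,C_P'V_{\max}k)$. Let $\epsilon>0$ and $m\in\mathbb N$, let $C_s$, $C_c$ and $C_d$ be the constants specified in the context ($C_d$ being associated with this $\epsilon$), and suppose $$\max(C_d,C_s)\,k\left((C_{\mathrm{stab}}(k)+H)\exp\left(-m^{(\frac1{d+1}-\epsilon)}\right)+H\right)\le \frac{1}{4C_cV_{\max}} .$$ Let $S=V_{H,m}+\overline{V_{H,m}}$, where $\overline{V_{H,m}}=\{\bar v:v\in V_{H,m}\}$, and let $u_S\in S$ be the Ritz–Galerkin solution, i.e. $$a(u_S,v)=(f,v)_\Omega-a(u^{\mathsf b}+u^{\mathsf s},v)\qquad\text{for all } v\in S .$$ Then $$\|u^{\mathsf h}-u^{\mathsf s}-u_S\|_{\mathcal H(\Omega)}\le 2C_cC_d\,(C_{\mathrm{stab}}(k)+H)\exp\left(-m^{(\frac1{d+1}-\epsilon)}\right)\|f\|_{L^2(\Omega)} .$$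
   Context: **Helmholtz problem.** $\Omega\subset\mathbb R^d$ is a bounded domain with Lipschitz boundary $\Gamma=\Gamma_D\cup\Gamma_N\cup\Gamma_R$ (disjoint parts); $k>0$ is real. $A,\beta,V$ are real functions with $0<A_{\min}\le A\le A_{\max}$, $0<\beta_{\min}\le\beta\le\beta_{\max}$, $0<V_{\min}\le V\le V_{\max}$. Functions are complex valued, $(u,v)_D=\int_D u\bar v$. $\mathcal H(\Omega)=\{u\in H^1(\Omega):u|_{\Gamma_D}=0\}$ with $\|u\|_{\mathcal H(\Omega)}^2=\int_\Omega A|\nabla u|^2+k^2V^2|u|^2$; for a subdomain $D$, $\mathcal H(D)$ is the space of restrictions to $D$ of functions in $\mathcal H(\Omega)$, with $\|u\|_{\mathcal H(D)}^2=\int_D A|\nabla u|^2+k^2V^2|u|^2$. $T_ku=0$ on $\Gamma_N$, $T_ku=ik\beta u$ on $\Gamma_R$. $a(u,v)=(A\nabla u,\nabla v)_\Omega-k^2(V^2u,v)_\Omega-(T_ku,v)_{\Gamma_N\cup\Gamma_R}$. $C_c$ is a constant independent of $k$ with $|a(u,v)|\le C_c\|u\|_{\mathcal H(\Omega)}\|v\|_{\mathcal H(\Omega)}$ on $\mathcal H(\Omega)$. Stability hypothesis: for each $f\in L^2(\Omega)$ there is a unique $u=N_kf\in\mathcal H(\Omega)$ with $a(u,v)=(f,v)_\Omega$ for all $v\in\mathcal H(\Omega)$, and $C_{\mathrm{stab}}(k):=\sup_{f\ne0}\|N_kf\|_{\mathcal H(\Omega)}/\|f\|_{L^2(\Omega)}<\infty$.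 Here $u=N_kf$. The typical mild conditions on the data for classical Hölder estimates for elliptic problems with these boundary conditions are assumed throughout; constants are understood with the bounds on the coefficients fixed. **Mesh.** $\mathcal T_H$ is a shape regular, uniform partition of $\Omega$ into elements (triangles or quadrilaterals), each connected component of $\Omega$ containing at least two elements, with $\max_T\operatorname{diam}T=H$, $\min_T\operatorname{diam}T\ge c_0H$, $\operatorname{diam}(T)^d/|T|\le c_1$. $\mathcal E_H$ is the set of edges $e=\overline T_i\cap\overline T_j$ (codimension 1, $T_i\ne T_j$) and $E_H=\bigcup_{e\in\mathcal E_H}e$. $\mathcal N_H$ is the set of mesh nodes that are endpoints of edges in $\mathcal E_H$ and do not lie in $\overline{\Gamma_D}$. For $e\in\mathcal E_H$, $\omega_e=\overline{\bigcup\{T\in\mathcal T_H:\overline T\cap e\ne\emptyset\}}$. $C_P$ is a constant depending only on $c_0,c_1,d$ with $\|v\|_{L^2(T)}\le C_PH\|\nabla v\|_{L^2(T)}$ for all $T\in\mathcal T_H$ and $v\in H^1(T)$ vanishing on one edge of $T$; $C_P'\ge C_P$ is a constant depending only on $c_0,c_1,d$ and the choice of $\omega_e$ with $\|v\|_{L^2(\omega_e)}\le C_P'H\|\nabla v\|_{L^2(\omega_e)}$ for all $e$ and $v\in H^1(\omega_e)$ vanishing on one of the boundary edges of $\omega_e$. **Decomposition.** For $D=T\in\mathcal T_H$ or $D=\omega_e$, write $u=u_D^{\mathsf h}+u_D^{\mathsf b}$ in $D$, where (weakly) $-\nabla\cdot(A\nabla u_D^{\mathsf h})-k^2V^2u_D^{\mathsf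 h}=0$ in $D$, $u_D^{\mathsf h}=u$ on $\partial D\setminus(\Gamma_N\cup\Gamma_R)$, $A\nabla u_D^{\mathsf h}\cdot\nu=T_ku_D^{\mathsf h}$ on $\partial D\cap(\Gamma_N\cup\Gamma_R)$; and $-\nabla\cdot(A\nabla u_D^{\mathsf b})-k^2V^2u_D^{\mathsf b}=f$ in $D$, $u_D^{\mathsf b}=0$ on $\partial D\setminus(\Gamma_N\cup\Gamma_R)$, $A\nabla u_D^{\mathsf b}\cdot\nu=T_ku_D^{\mathsf b}$ on $\partial D\cap(\Gamma_N\cup\Gamma_R)$. Globally, $u^{\mathsf h}=u_T^{\mathsf h}$ and $u^{\mathsf b}=u_T^{\mathsf b}$ in each $T$. $V^{\mathsf h}$ is the space of $v\in\mathcal H(\Omega)$ with $-\nabla\cdot(A\nabla v)-k^2V^2v=0$ in each $T$ and $A\nabla v\cdot\nu=T_kv$ on $\Gamma_N\cup\Gamma_R$. Functions $\psi\in V^{\mathsf h}$ correspond one-to-one to their traces $\tilde\psi=\psi|_{E_H}$; $\tilde V^{\mathsf h}$ is the space of these traces, and a tilde denotes the trace. **Edge functions.** For $x_i\in\mathcal N_H$, $\tilde\psi_i$ is the piecewise linear tent function on $E_H$ with $\tilde\psi_i(x_j)=\delta_{ij}$, $\psi_i\in V^{\mathsf h}$ its extension, $I_Hv=\sum_{x_i\in\mathcal N_H}v(x_i)\psi_i$. $R_ev:=(v-I_Hv)|_e$, i.e. $v|_e$ minus the affine function on $e$ with the same values at the endpoints of $e$. $H_{00}^{1/2}(e)=\{w\in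 H^{1/2}(e):w/\operatorname{dist}(\cdot,\partial e)\in L^2(e)\}$; its elements are extended by zero to $E_H$. For $\tilde\psi\in H_{00}^{1/2}(e)$, $\|\tilde\psi\|_{\mathcal H^{1/2}(e)}^2=\int_\Omega A|\nabla\psi|^2+k^2|V\psi|^2$ with $\psi\in V^{\mathsf h}$ the function corresponding to the zero extension of $\tilde\psi$. $U(\omega_e)$ is the space of $v\in\mathcal H(\omega_e)$ with $-\nabla\cdot(A\nabla v)-k^2V^2v=0$ in $\omega_e$ and $A\nabla v\cdot\nu=T_kv$ on $(\Gamma_N\cup\Gamma_R)\cap\partial\omega_e$. $\tilde v_{1,e},\tilde v_{2,e},\dots$ are the left singular vectors, ordered by decreasing singular value, of the compact operator $R_e:(U(\omega_e),\|\cdot\|_{\mathcal H(\omega_e)})\to(H_{00}^{1/2}(e),\|\cdot\|_{\mathcal H^{1/2}(e)})$. $W_{m,e}=\operatorname{span}\{\tilde v_{j,e}\}_{j=1}^{m-1}$. $\tilde V_{H,m}$ is the span of all $\tilde\psi_i$ ($x_i\in\mathcal N_H$) and all $W_{m,e}$ ($e\in\mathcal E_H$); $V_{H,m}\subset V^{\mathsf h}$ is the corresponding space of extensions. $u^{\mathsf s}\in V^{\mathsf h}$ is the function whose trace on each $e\in\mathcal E_H$ is $R_eu_{\omega_e}^{\mathsf b}$. **Constants.** $C_s$ is a constant independent of $k,H$ with $\|u^{\mathsf s}\|_{\mathcal H(\Omega)}+\|u^{\mathsf b}\|_{\mathcal H(\Omega)}\le C_sH\|f\|_{L^2(\Omega)}$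 for all $f\in L^2(\Omega)$. For given $\epsilon>0$, $C_d$ is a constant independent of $k,m,H$ with $\min_{v\in V_{H,m}}\|u^{\mathsf h}-u^{\mathsf s}-v\|_{\mathcal H(\Omega)}\le C_d(C_{\mathrm{stab}}(k)+H)\exp(-m^{(\frac1{d+1}-\epsilon)})\|f\|_{L^2(\Omega)}$ for all $f\in L^2(\Omega)$ (such constants exist under the stated mesh and stability hypotheses). *)

(* Defs.v *)
From HB Require Import structures.
From mathcomp Require Import all_boot all_order all_algebra.
From mathcomp Require Import complex.
From mathcomp Require Import all_classical all_reals all_analysis.
Set Implicit Arguments.
Unset Strict Implicit.
Unset Printing Implicit Defensive.
Import Order.TTheory GRing.Theory Num.Theory.
Import numFieldNormedType.Exports.
Local Open Scope classical_set_scope.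
Local Open Scope ring_scope.
Local Open Scope complex_scope.

Notation plane R := (R * R)%type (only parsing).

(* A side is an oriented segment, given by its two end points. *)
Notation side R := ((R * R) * (R * R))%type (only parsing).

Notation area := (lebesgue_measure \x lebesgue_measure)%E (only parsing).

Definition I01 (R : realType) : set R := `[0, 1].
Arguments I01 R : clear implicits.

(** * Plane geometry *)

(* The norm of the library on R * R is the maximum norm, hence this one. *)
Definition edist (R : realType) (x y : plane R) : R :=
  Num.sqrt ((x.1 - y.1) ^+ 2 + (x.2 - y.2) ^+ 2).

Definition diam (R : realType) (D : set (plane R)) : R :=
  sup [set r | exists x y, [/\ D x, D y & r = edist x y]].

Definition bd (R : realType) (D : set (plane R)) : set (plane R) :=
  closure D `\` interior D.

Definition spt (R : realType) (s : side R) (t : R) : plane R :=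
  ((1 - t) * s.1.1 + t * s.2.1, (1 - t) * s.1.2 + t * s.2.2).

Definition seg (R : realType) (s : side R) : set (plane R) :=
  [set spt s t | t in I01 R].

(* Positive when x lies strictly to the left of the oriented line pq. *)
Definition cross (R : realType) (p q x : plane R) : R :=
  (q.1 - p.1) * (x.2 - p.2) - (q.2 - p.2) * (x.1 - p.1).

(* Elements are triangles or (strictly convex) quadrilaterals, given by the
   list of their vertices in counterclockwise order. *)
Definition is_elt (R : realType) (T : seq (plane R)) : Prop :=
  (size T == 3%N \/ size T == 4%N) /\
  forall i, (i < size T)%N ->
    0 < cross (nth 0 T i) (nth 0 (rot 1 T) i) (nth 0 (rot 2 T) i).

Definition sides (R : realType) (T : seq (plane R)) : seq (side R) :=
  zip T (rot 1 T).

Definition elt (R : realType) (T : seq (plane R)) : set (plane R) :=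
  [set x | forall s : side R, s \in sides T -> 0 < cross s.1 s.2 x].

Definition celt (R : realType) (T : seq (plane R)) : set (plane R) :=
  [set x | forall s : side R, s \in sides T -> 0 <= cross s.1 s.2 x].

(* Near each of its boundary points, in suitable orthonormal coordinates
   (r, t), the set is the strict epigraph of a Lipschitz function g. *)
Definition lipschitz_boundary (R : realType) (D : set (plane R)) : Prop :=
  forall p, bd D p -> exists (a b r h L : R) (g : R -> R),
    [/\ a ^+ 2 + b ^+ 2 = 1, 0 < r, 0 < h,
        forall x y, `|g x - g y| <= L * `|x - y|
      & forall x y, `|x| < r -> `|y| < h -> `|g x| < h /\
          (D (p.1 + x * a - y * b, p.2 + x * b + y * a) <-> g x < y)].

(** * Complex valued functions *)

Definition csq (R : realType) (z : R[i]) : R :=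
  complex.Re z ^+ 2 + complex.Im z ^+ 2.

Definition cabs (R : realType) (z : R[i]) : R := Num.sqrt (csq z).

Definition cint (R : realType) (D : set (plane R)) (f : plane R -> R[i]) :
    R[i] :=
  (\int[area]_(x in D) complex.Re (f x)) +i*
  (\int[area]_(x in D) complex.Im (f x)).

(* Integral over a side with respect to arc length. *)
Definition sint (R : realType) (s : side R) (f : plane R -> R[i]) : R[i] :=
  (edist s.1 s.2 *
     \int[lebesgue_measure]_(t in I01 R) complex.Re (f (spt s t))) +i*
  (edist s.1 s.2 *
     \int[lebesgue_measure]_(t in I01 R) complex.Im (f (spt s t))).

Definition ae_in (R : realType) (D : set (plane R)) (Q : plane R -> Prop) :
    Prop :=
  {ae area, forall x : plane R, D x -> Q x}.

Definition ae_side (R : realType) (s : side R) (Q : plane R -> Prop) : Prop :=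
  {ae lebesgue_measure, forall t : R, I01 R t -> Q (spt s t)}.

Definition inL2 (R : realType) (D : set (plane R)) (f : plane R -> R[i]) :
    Prop :=
  [/\ measurable_fun D (fun x => complex.Re (f x)),
      measurable_fun D (fun x => complex.Im (f x))
    & (\int[area]_(x in D) (csq (f x))%:E < +oo)%E].

Definition inL2_side (R : realType) (s : side R) (f : plane R -> R[i]) : Prop :=
  [/\ measurable_fun (I01 R) (fun t => complex.Re (f (spt s t))),
      measurable_fun (I01 R) (fun t => complex.Im (f (spt s t)))
    & (\int[lebesgue_measure]_(t in I01 R) (csq (f (spt s t)))%:E < +oo)%E].

Definition inner (R : realType) (D : set (plane R)) (f g : plane R -> R[i]) :
    R[i] :=
  cint D (fun x => f x * (g x)^*).

Definition normL2 (R : realType) (D : set (plane R)) (f : plane R -> R[i]) :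
    R :=
  Num.sqrt (\int[area]_(x in D) csq (f x)).

(** * Sobolev functions *)

Fixpoint Cn (R : realType) (n : nat) (f : plane R -> R) : Prop :=
  if n is n'.+1 then
    [/\ continuous f,
        forall x, derivable f x (1, 0) /\ derivable f x (0, 1),
        Cn n' (fun x => 'D_((1, 0) : plane R) f x)
      & Cn n' (fun x => 'D_((0, 1) : plane R) f x)]
  else continuous f.

Definition smooth (R : realType) (f : plane R -> R) : Prop :=
  forall n, Cn n f.

Definition test_function (R : realType) (D : set (plane R))
    (phi : plane R -> R) : Prop :=
  [/\ smooth phi, compact (closure [set x | phi x != 0])
    & closure [set x | phi x != 0] `<=` D].

(* A Sobolev function is carried together with its weak partial derivatives
   and its trace on the sides of a mesh; H1 below ties these components to
   the function. *)
Record sob (R : realType) := Sob {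
  fn : plane R -> R[i];
  dx : plane R -> R[i];
  dy : plane R -> R[i];
  tr : plane R -> R[i] }.

Definition sob0 (R : realType) : sob R :=
  Sob (fun=> 0) (fun=> 0) (fun=> 0) (fun=> 0).

Definition sobD (R : realType) (u v : sob R) : sob R :=
  Sob (fun x => fn u x + fn v x) (fun x => dx u x + dx v x)
      (fun x => dy u x + dy v x) (fun x => tr u x + tr v x).

Definition sobZ (R : realType) (c : R[i]) (u : sob R) : sob R :=
  Sob (fun x => c * fn u x) (fun x => c * dx u x)
      (fun x => c * dy u x) (fun x => c * tr u x).

Definition sobB (R : realType) (u v : sob R) : sob R := sobD u (sobZ (- 1) v).

Definition sobC (R : realType) (u : sob R) : sob R :=
  Sob (fun x => (fn u x)^*) (fun x => (dx u x)^*)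
      (fun x => (dy u x)^*) (fun x => (tr u x)^*).

(* The function p + i q with its classical gradient and its restriction to
   sides. *)
Definition sob_of (R : realType) (p q : plane R -> R) : sob R :=
  Sob (fun x => p x +i* q x)
      (fun x => 'D_((1, 0) : plane R) p x +i* 'D_((1, 0) : plane R) q x)
      (fun x => 'D_((0, 1) : plane R) p x +i* 'D_((0, 1) : plane R) q x)
      (fun x => p x +i* q x).

Definition sobL2 (R : realType) (D : set (plane R)) (ss : seq (side R))
    (u : sob R) : Prop :=
  [/\ inL2 D (fn u), inL2 D (dx u), inL2 D (dy u)
    & forall s : side R, s \in ss -> inL2_side s (tr u)].

Definition weak_gradient (R : realType) (D : set (plane R)) (u : sob R) :
    Prop :=
  forall phi, test_function D phi ->
    cint D (fun x => fn u x * ('D_((1, 0) : plane R) phi x)%:C) =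
      - cint D (fun x => dx u x * (phi x)%:C) /\
    cint D (fun x => fn u x * ('D_((0, 1) : plane R) phi x)%:C) =
      - cint D (fun x => dy u x * (phi x)%:C).

(* The trace operator is the continuous extension of the restriction map from
   the smooth functions, which are dense in H^1: tr u is the L^2 limit of the
   restrictions of smooth functions converging to u in H^1. *)
Definition has_trace (R : realType) (D : set (plane R)) (ss : seq (side R))
    (u : sob R) : Prop :=
  exists p q : nat -> plane R -> R, let w n := sob_of (p n) (q n) in
    [/\ forall n, [/\ smooth (p n), smooth (q n) & sobL2 D ss (w n)],
        (fun n => \int[area]_(x in D) (csq (fn (w n) x - fn u x))%:E)%E
          @ \oo --> 0%E,
        (fun n => \int[area]_(x in D) (csq (dx (w n) x - dx u x))%:E)%E
          @ \oo --> 0%E,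
        (fun n => \int[area]_(x in D) (csq (dy (w n) x - dy u x))%:E)%E
          @ \oo --> 0%E
      & forall s : side R, s \in ss ->
        (fun n => \int[lebesgue_measure]_(t in I01 R)
            (csq (tr (w n) (spt s t) - tr u (spt s t)))%:E)%E @ \oo --> 0%E].

(* H^1(D), with the traces recorded on the sides in ss. *)
Definition H1 (R : realType) (D : set (plane R)) (ss : seq (side R))
    (u : sob R) : Prop :=
  [/\ sobL2 D ss u, weak_gradient D u & has_trace D ss u].

(** * The Helmholtz problem and the mesh *)

Record problem (R : realType) := Problem {
  dom : set (plane R);
  GammaD : set (plane R);
  GammaN : set (plane R);
  GammaR : set (plane R);
  kk : R;
  cA : plane R -> R;
  cbeta : plane R -> R;
  cV : plane R -> R;
  Amin : R; Amax : R; betamin : R; betamax : R; Vmin : R; Vmax : R;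
  mesh : seq (seq (plane R)) }.

Definition helmholtz_data (R : realType) (P : problem R) : Prop :=
  [/\ [/\ open (dom P), dom P !=set0, bounded_set (dom P)
        & lipschitz_boundary (dom P)],
      [/\ measurable (GammaD P), measurable (GammaN P), measurable (GammaR P)
        & GammaD P `|` GammaN P `|` GammaR P = bd (dom P)],
      [/\ GammaD P `&` GammaN P = set0, GammaD P `&` GammaR P = set0
        & GammaN P `&` GammaR P = set0],
      [/\ measurable_fun (dom P) (cA P), measurable_fun (dom P) (cV P)
        & measurable_fun (GammaR P) (cbeta P)]
    & [/\ 0 < kk P, 0 < Amin P, 0 < betamin P & 0 < Vmin P] /\
      [/\ forall x, dom P x -> Amin P <= cA P x <= Amax P,
          forall x, GammaR P x -> betamin P <= cbeta P x <= betamax P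
        & forall x, dom P x -> Vmin P <= cV P x <= Vmax P]].

Definition all_sides (R : realType) (P : problem R) : seq (side R) :=
  flatten [seq sides T | T <- mesh P].

Definition mesh_hyp (R : realType) (P : problem R) (c0 c1 H : R) : Prop :=
  let M := mesh P in let K i := nth [::] M i in
  [/\ (forall T, T \in M -> is_elt T /\ elt T `<=` dom P) /\
      closure (dom P) = [set x | exists2 T, T \in M & celt T x],
      forall i j, (i < j < size M)%N -> elt (K i) `&` elt (K j) = set0 /\
        [\/ celt (K i) `&` celt (K j) = set0,
            exists p : plane R, [/\ p \in K i, p \in K j &
              celt (K i) `&` celt (K j) = [set p]]
          | exists s : side R, [/\ s \in sides (K i),
              (s.2, s.1) \in sides (K j) &
              celt (K i) `&` celt (K j) = seg s]],
      forall x, dom P x -> exists i j, (i < j < size M)%N /\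
        elt (K i) `<=` connected_component (dom P) x /\
        elt (K j) `<=` connected_component (dom P) x,
      [/\ forall T, T \in M -> diam (elt T) <= H,
          exists2 T, T \in M & diam (elt T) = H,
          0 < c0
        & forall T, T \in M -> c0 * H <= diam (elt T)]
    & forall T, T \in M -> diam (elt T) ^+ 2 / fine (area (elt T)) <= c1].

Definition is_edge (R : realType) (P : problem R) (e : side R) : Prop :=
  exists i j, [/\ (i < j < size (mesh P))%N,
    e \in sides (nth [::] (mesh P) i)
  & seg e = celt (nth [::] (mesh P) i) `&` celt (nth [::] (mesh P) j)].

(* The index condition i < j selects one orientation of each edge. *)
Definition edges (R : realType) (P : problem R) : seq (side R) :=
  [seq e <- all_sides P | `[< is_edge P e >]].

Definition nodes (R : realType) (P : problem R) : seq (plane R) :=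
  [seq x <- undup (flatten [seq [:: e.1; e.2] | e <- edges P])
     | `[< ~ closure (GammaD P) x >]].

Definition bsides (R : realType) (P : problem R) : seq (side R) :=
  [seq s <- all_sides P | `[< seg s `<=` bd (dom P) >]].

(* The interior of the closed patch omega_e. *)
Definition edge_patch (R : realType) (P : problem R) (e : side R) :
    set (plane R) :=
  interior [set x | exists T,
    [/\ T \in mesh P, celt T `&` seg e !=set0 & celt T x]].

(* Below, D is an open union of elements (dom P, an element or a patch).  A
   function of H(D), being the restriction of a function of H(dom P), is
   represented by the latter; only its values in D and its traces on the sides
   contained in the closure of D are used. *)

Definition Tk (R : realType) (P : problem R) (g : plane R -> R[i])
    (x : plane R) : R[i] :=
  if x \in GammaR P then (0 +i* (kk P * cbeta P x)) * g x else 0.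

Definition aform (R : realType) (P : problem R) (D : set (plane R))
    (u v : sob R) : R[i] :=
  inner D (fun x => (cA P x)%:C * dx u x) (dx v)
  + inner D (fun x => (cA P x)%:C * dy u x) (dy v)
  - (kk P ^+ 2)%:C * inner D (fun x => (cV P x ^+ 2)%:C * fn u x) (fn v)
  - \sum_(s <- bsides P) sint s (fun x =>
      if x \in (GammaN P `|` GammaR P) `&` bd D
      then Tk P (tr u) x * (tr v x)^* else 0).

Definition ipH (R : realType) (P : problem R) (D : set (plane R))
    (u v : sob R) : R[i] :=
  inner D (fun x => (cA P x)%:C * dx u x) (dx v)
  + inner D (fun x => (cA P x)%:C * dy u x) (dy v)
  + (kk P ^+ 2)%:C * inner D (fun x => (cV P x ^+ 2)%:C * fn u x) (fn v).

Definition normH (R : realType) (P : problem R) (D : set (plane R))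
    (u : sob R) : R :=
  Num.sqrt (\int[area]_(x in D)
    (cA P x * (csq (dx u x) + csq (dy u x))
     + kk P ^+ 2 * cV P x ^+ 2 * csq (fn u x))).

Definition sob_eq (R : realType) (P : problem R) (D : set (plane R))
    (u v : sob R) : Prop :=
  ae_in D (fun x => [/\ fn u x = fn v x, dx u x = dx v x & dy u x = dy v x]) /\
  forall s : side R, s \in all_sides P -> seg s `<=` closure D ->
    ae_side s (fun x => tr u x = tr v x).

Definition inH (R : realType) (P : problem R) (u : sob R) : Prop :=
  H1 (dom P) (all_sides P) u /\
  forall s : side R, s \in all_sides P ->
    ae_side s (fun x => GammaD P x -> tr u x = 0).

(* Functions of H(D) vanishing on the part of bd D where the local problems
   carry a Dirichlet condition. *)
Definition inH0 (R : realType) (P : problem R) (D : set (plane R))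
    (w : sob R) : Prop :=
  inH P w /\
  forall s : side R, s \in all_sides P ->
    ae_side s (fun x => (bd D `\` (GammaN P `|` GammaR P)) x -> tr w x = 0).

(* Weak form of - div (A grad v) - k^2 V^2 v = f in D with
   A grad v . nu = T_k v on the part of bd D in GammaN and GammaR. *)
Definition weak_eq (R : realType) (P : problem R) (D : set (plane R))
    (f : plane R -> R[i]) (v : sob R) : Prop :=
  forall w, inH0 P D w -> aform P D v w = inner D f (fn w).

Definition homog (R : realType) (P : problem R) (D : set (plane R))
    (v : sob R) : Prop :=
  weak_eq P D (fun=> 0) v.

Definition poincare (R : realType) (P : problem R) (H : R)
    (D : set (plane R)) (C : R) : Prop :=
  forall (s : side R) v, s \in all_sides P -> seg s `<=` bd D ->
    H1 D [seq s' <- all_sides P | `[< seg s' `<=` closure D >]] v ->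
    ae_side s (fun x => tr v x = 0) ->
    normL2 D (fn v) <=
      C * H * Num.sqrt (normL2 D (dx v) ^+ 2 + normL2 D (dy v) ^+ 2).

Definition is_sol (R : realType) (P : problem R) (f : plane R -> R[i])
    (u : sob R) : Prop :=
  inH P u /\
  forall v, inH P v -> aform P (dom P) u v = inner (dom P) f (fn v).

Definition Cstab (R : realType) (P : problem R) : \bar R :=
  ereal_sup [set r | exists f u, [/\ inL2 (dom P) f, normL2 (dom P) f != 0,
    is_sol P f u & r = (normH P (dom P) u / normL2 (dom P) f)%:E]].

Definition stability (R : realType) (P : problem R) : Prop :=
  (forall f, inL2 (dom P) f ->
    (exists u, is_sol P f u) /\
    (forall u u', is_sol P f u -> is_sol P f u' -> sob_eq P (dom P) u u')) /\
  (Cstab P < +oo)%E.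

(** * Decomposition and edge functions *)

Definition local_h (R : realType) (P : problem R) (D : set (plane R))
    (u v : sob R) : Prop :=
  [/\ inH P v, homog P D v
    & forall s : side R, s \in all_sides P -> ae_side s (fun x =>
        (bd D `\` (GammaN P `|` GammaR P)) x -> tr v x = tr u x)].

Definition local_b (R : realType) (P : problem R) (D : set (plane R))
    (f : plane R -> R[i]) (v : sob R) : Prop :=
  inH0 P D v /\ weak_eq P D f v.

Definition inVh (R : realType) (P : problem R) (v : sob R) : Prop :=
  inH P v /\ forall T, T \in mesh P -> homog P (elt T) v.

Definition inU (R : realType) (P : problem R) (e : side R) (v : sob R) : Prop :=
  inH P v /\ homog P (edge_patch P e) v.

(* w = R_e v on e; the point values of v at the end points of e are those of
   the continuous representative c of its trace on e. *)
Definition is_Re (R : realType) (e : side R) (v : sob R)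
    (w : plane R -> R[i]) : Prop :=
  exists c : R -> R[i],
    [/\ {within I01 R, continuous (fun t => complex.Re (c t))},
        {within I01 R, continuous (fun t => complex.Im (c t))},
        {ae lebesgue_measure, forall t : R, I01 R t ->
          tr v (spt e t) = c t}
      & {ae lebesgue_measure, forall t : R, I01 R t ->
          w (spt e t) = c t - ((1 - t)%:C * c 0 + t%:C * c 1)}].

(* uh and ub are glued from the element contributions, which agree with u,
   respectively 0, on the element boundaries. *)
Definition decomposition (R : realType) (P : problem R)
    (f : plane R -> R[i]) (u uh ub us : sob R) : Prop :=
  [/\ is_sol P f u,
      inVh P uh /\ inH P ub,
      sob_eq P (dom P) u (sobD uh ub),
      forall T, T \in mesh P -> local_h P (elt T) u uh /\ local_b P (elt T) f ub
    & inVh P us /\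
      forall e : side R, e \in edges P -> exists uhe ube : sob R,
        [/\ local_h P (edge_patch P e) u uhe, local_b P (edge_patch P e) f ube,
            sob_eq P (edge_patch P e) u (sobD uhe ube)
          & is_Re e ube (tr us)]].

(* H^{1/2}(e) is the Sobolev-Slobodeckij space. *)
Definition inH00 (R : realType) (e : side R) (w : plane R -> R[i]) : Prop :=
  [/\ inL2_side e w,
      (\int[area]_(z in (I01 R `*` I01 R)%classic)
        (csq (w (spt e z.1) - w (spt e z.2))
          / edist (spt e z.1) (spt e z.2) ^+ 2)%:E < +oo)%E
    & (\int[lebesgue_measure]_(t in I01 R)
        (csq (w (spt e t))
          / (edist e.1 e.2 * Num.min t (1 - t)) ^+ 2)%:E < +oo)%E].

(* psi is the function of V^h whose trace is the extension by zero of w. *)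
Definition ext0 (R : realType) (P : problem R) (e : side R)
    (w : plane R -> R[i]) (psi : sob R) : Prop :=
  [/\ inVh P psi, ae_side e (fun x => tr psi x = w x)
    & forall e' : side R, e' \in edges P -> e' != e ->
        ae_side e' (fun x => tr psi x = 0)].

(* Singular value (Schmidt) decomposition of the compact operator R_e, with
   singular values sg, left singular vectors w and right singular vectors r.
   If R_e has finite rank, the sequences are continued by zeros. *)
Definition singular_system (R : realType) (P : problem R) (e : side R)
    (sg : nat -> R) (w : nat -> plane R -> R[i]) : Prop :=
  exists r psi : nat -> sob R,
  [/\ [/\ forall j, 0 <= sg j, forall i j, (i <= j)%N -> sg j <= sg i
        & sg @ \oo --> 0],
      forall j, [/\ inU P e (r j), inH00 e (w j), ext0 P e (w j) (psi j)
        & is_Re e (r j) (fun x => (sg j)%:C * w j x)],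
      forall j, sg j = 0 -> ae_side e (fun x => w j x = 0),
      forall i j, 0 < sg i -> 0 < sg j ->
        ipH P (edge_patch P e) (r i) (r j) = (i == j)%:R /\
        ipH P (dom P) (psi i) (psi j) = (i == j)%:R
    & forall v, inU P e v -> exists g phi,
        [/\ is_Re e v g, inH00 e g, ext0 P e g phi
          & (fun n => normH P (dom P) (sobB phi
               (\big[@sobD R/sob0 R]_(j < n)
                 sobZ ((sg j)%:C * ipH P (edge_patch P e) v (r j)) (psi j))))
            @ \oo --> 0]].

Definition tent (R : realType) (x : plane R) (e : side R) (t : R) : R :=
  (1 - t) * (e.1 == x)%:R + t * (e.2 == x)%:R.

(* The left singular vectors are numbered from 0 here. *)
Definition inVHm (R : realType) (P : problem R)
    (w : side R -> nat -> plane R -> R[i]) (m : nat) (v : sob R) : Prop :=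
  inVh P v /\
  exists (c : plane R -> R[i]) (b : side R -> nat -> R[i]),
    forall e : side R, e \in edges P ->
      {ae lebesgue_measure, forall t : R, I01 R t ->
        tr v (spt e t) = \sum_(x <- nodes P) c x * (tent x e t)%:C
                         + \sum_(j < m.-1) b e j * w e j (spt e t)}.

(* V_{H,m} + conj(V_{H,m}) *)
Definition inS (R : realType) (P : problem R)
    (w : side R -> nat -> plane R -> R[i]) (m : nat) (v : sob R) : Prop :=
  exists v1 v2, [/\ inVHm P w m v1, inVHm P w m v2 & v = sobD v1 (sobC v2)].

Definition approx_rate (R : realType) (P : problem R) (H eps : R) (m : nat) :
    R :=
  let d := 2%N in
  (fine (Cstab P) + H) * expR (- (m%:R `^ ((d.+1)%:R^-1 - eps))).

(** * The constants *)

Definition continuity_const (R : realType) (P : problem R) (Cc : R) : Prop :=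
  0 < Cc /\
  forall u v, inH P u -> inH P v ->
    cabs (aform P (dom P) u v) <= Cc * normH P (dom P) u * normH P (dom P) v.

Definition bubble_const (R : realType) (P : problem R) (H : R)
    (ub us : (plane R -> R[i]) -> sob R) (Cs : R) : Prop :=
  forall f, inL2 (dom P) f ->
    normH P (dom P) (us f) + normH P (dom P) (ub f)
      <= Cs * H * normL2 (dom P) f.

(* A finite dimensional distance is at most a bound if and only if some
   element of the space realizes the bound. *)
Definition approx_const (R : realType) (P : problem R) (H eps : R)
    (w : side R -> nat -> plane R -> R[i])
    (uh us : (plane R -> R[i]) -> sob R) (Cd : R) : Prop :=
  forall (m : nat) f, inL2 (dom P) f -> exists2 v, inVHm P w m v &
    normH P (dom P) (sobB (sobB (uh f) (us f)) v)
      <= Cd * approx_rate P H eps m * normL2 (dom P) f.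

(* Main.v *)
Require Import Defs.
From HB Require Import structures.
From mathcomp Require Import all_boot all_order all_algebra.
From mathcomp Require Import complex.
From mathcomp Require Import all_classical all_reals all_analysis.
From mathcomp Require Import measurable_realfun.
From mathcomp Require Import ring lra.
Set Implicit Arguments.
Unset Strict Implicit.
Unset Printing Implicit Defensive.
Import Order.TTheory GRing.Theory Num.Theory.
Import numFieldNormedType.Exports.
Local Open Scope classical_set_scope.
Local Open Scope ring_scope.
Local Open Scope complex_scope.

(** The estimate is Schatz's duality argument for forms that are coercive up to
    a lower order term.

    Let e = uh - us - uS.  Since u = uh + ub solves the problem with load f, the
    equation defining uS says that a(e, v) = 0 for all v in S = Y + conj Y,
    where Y is the coarse space.  The impedance term is purely imaginary, hence
    Re a(e, e) = |e|_H^2 - 2 k^2 |V e|^2 ([Re_aform_diag]), and by orthogonality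
    a(e, e) = a(e, uh - us - y) for the approximation y of uh - us in Y, which
    bounds Re a(e, e) by Cc |e|_H times Cd * rate * |f|.  It remains to absorb
    the negative term.

    To bound |V e|, let n be the solution with the load g = conj (V^2 e).  The
    coefficients are real, so a(p, conj q) = a(q, conj p) ([aform_sym]): the
    conjugate of n solves the adjoint problem, and
    |V e|^2 = (g, conj e) = a(n, conj e).  Write n = (nh - ns - z) + ns + nb + z
    with z in Y close to nh - ns.  Then a(z, conj e) = a(e, conj z) = 0; this is
    where S has to contain conj Y.  The three other parts are small, of size
    Cd * rate * |g| and Cs * H * |g|, and |g| <= Vmax |V e|
    ([normL2_dual_load]).  The smallness condition turns this into
    k |V e| <= |e|_H / 4, so the negative term is at most |e|_H^2 / 8, and
    [schatz_bound] concludes, as 8/7 <= 2.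

    The rest provides what these few lines take for granted: additivity of the
    sesquilinear form, which rests on the integrability of each of its terms,
    its invariance under almost everywhere equality, and stability of the energy
    space under sums and conjugation.  The last point concerns traces and weak
    gradients: traces are defined by approximating smooth functions, and weak
    gradients by test functions, which are bounded on the bounded domain. *)

(** * Complex numbers *)

Lemma csq_ge0 (R : realType) (z : R[i]) : 0 <= csq z.
Proof. by rewrite addr_ge0 // sqr_ge0. Qed.

Lemma csqM (R : realType) (z w : R[i]) : csq (z * w) = csq z * csq w.
Proof. by case: z w => [a b] [c d]; rewrite /csq /=; ring. Qed.

Lemma csqJ (R : realType) (z : R[i]) : csq (conjc z) = csq z.
Proof. by case: z => a b; rewrite /csq /= sqrrN. Qed.

Lemma csqN (R : realType) (z : R[i]) : csq (- z) = csq z.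
Proof. by case: z => a b; rewrite /csq /= !sqrrN. Qed.

Lemma csqD_le (R : realType) (z w : R[i]) :
  csq (z + w) <= 2 * csq z + 2 * csq w.
Proof.
case: z w => [a b] [c d]; rewrite /csq /=.
by have := sqr_ge0 (a - c); have := sqr_ge0 (b - d); nra.
Qed.

Lemma Re_cmul (R : realType) (z w : R[i]) :
  complex.Re (z * w) = complex.Re z * complex.Re w - complex.Im z * complex.Im w.
Proof. by case: z w => [a b] [c d]. Qed.

Lemma Im_cmul (R : realType) (z w : R[i]) :
  complex.Im (z * w) = complex.Re z * complex.Im w + complex.Im z * complex.Re w.
Proof. by case: z w => [a b] [c d]. Qed.

Lemma Re_cadd (R : realType) (z w : R[i]) :
  complex.Re (z + w) = complex.Re z + complex.Re w.
Proof. by case: z w => [a b] [c d]. Qed.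

Lemma Im_cadd (R : realType) (z w : R[i]) :
  complex.Im (z + w) = complex.Im z + complex.Im w.
Proof. by case: z w => [a b] [c d]. Qed.

Lemma Re_copp (R : realType) (z : R[i]) : complex.Re (- z) = - complex.Re z.
Proof. by case: z. Qed.

Lemma Im_copp (R : realType) (z : R[i]) : complex.Im (- z) = - complex.Im z.
Proof. by case: z. Qed.

Lemma Re_conjc (R : realType) (z : R[i]) : complex.Re (conjc z) = complex.Re z.
Proof. by case: z. Qed.

Lemma Im_conjc (R : realType) (z : R[i]) : complex.Im (conjc z) = - complex.Im z.
Proof. by case: z. Qed.

Lemma conjc_add (R : realType) (z w : R[i]) : conjc (z + w) = conjc z + conjc w.
Proof. by case: z w => [a b] [c d]; rewrite /= opprD. Qed.

Lemma conjc_mul (R : realType) (z w : R[i]) : conjc (z * w) = conjc z * conjc w.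
Proof.
by case: z w => [a b] [c d]; apply/eqP; rewrite eq_complex /=; apply/andP; split;
  apply/eqP; ring.
Qed.

Lemma conjc_ofreal (R : realType) (r : R) : conjc r%:C = r%:C :> R[i].
Proof. by apply/eqP; rewrite eq_complex /= oppr0 !eqxx. Qed.

Lemma conjc_opp (R : realType) (z : R[i]) : conjc (- z) = - conjc z.
Proof. by case: z. Qed.

Lemma conjc_conjc (R : realType) (z : R[i]) : conjc (conjc z) = z.
Proof. by case: z => a b; apply/eqP; rewrite eq_complex /= opprK !eqxx. Qed.

Lemma Re_le_cabs (R : realType) (z : R[i]) : complex.Re z <= cabs z.
Proof.
apply: le_trans (ler_norm _) _; rewrite -sqrtr_sqr ler_wsqrtr //.
by rewrite lerDl sqr_ge0.
Qed.

(** * Integrals of complex functions *)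

Section ComplexIntegral.
Context d (T : measurableType d) (R : realType) (mu : {measure set T -> \bar R}).
Variable D : set T.
Hypothesis mD : measurable D.
Implicit Types f g : T -> R[i].

Definition mfun_c f : Prop :=
  measurable_fun D (fun x => complex.Re (f x)) /\
  measurable_fun D (fun x => complex.Im (f x)).

(** Functions on the domain and on the parameter interval of a side are treated
    alike: inL2 and inL2_side are instances of this notion. *)
Definition sqint f : Prop :=
  [/\ measurable_fun D (fun x => complex.Re (f x)),
      measurable_fun D (fun x => complex.Im (f x))
    & (\int[mu]_(x in D) (csq (f x))%:E < +oo)%E].

Definition gint f : R[i] :=
  (\int[mu]_(x in D) complex.Re (f x)) +i*
  (\int[mu]_(x in D) complex.Im (f x)).

Definition cintegrable f : Prop :=
  mu.-integrable D (EFin \o (fun x => complex.Re (f x))) /\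
  mu.-integrable D (EFin \o (fun x => complex.Im (f x))).

Lemma measurable_csq f : mfun_c f -> measurable_fun D (fun x => csq (f x)).
Proof. by case=> mr mi; apply: measurable_funD; exact: measurable_funX. Qed.

Lemma mfun_cD f g : mfun_c f -> mfun_c g -> mfun_c (fun x => f x + g x).
Proof.
move=> [fr fi] [gr gi]; split.
  by under eq_fun do rewrite Re_cadd; exact: measurable_funD.
by under eq_fun do rewrite Im_cadd; exact: measurable_funD.
Qed.

Lemma mfun_cN f : mfun_c f -> mfun_c (fun x => - f x).
Proof.
move=> [fr fi]; split.
  by under eq_fun do rewrite Re_copp; exact: measurableT_comp.
by under eq_fun do rewrite Im_copp; exact: measurableT_comp.
Qed.

Lemma mfun_cM f g : mfun_c f -> mfun_c g -> mfun_c (fun x => f x * g x).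
Proof.
move=> [fr fi] [gr gi]; split.
  by under eq_fun do rewrite Re_cmul; apply: measurable_funB; exact: measurable_funM.
by under eq_fun do rewrite Im_cmul; apply: measurable_funD; exact: measurable_funM.
Qed.

Lemma mfun_cJ f : mfun_c f -> mfun_c (fun x => conjc (f x)).
Proof.
move=> [fr fi]; split; first by under eq_fun do rewrite Re_conjc.
by under eq_fun do rewrite Im_conjc; exact: measurableT_comp.
Qed.

Lemma sqint_mfun f : sqint f -> mfun_c f.
Proof. by case. Qed.

Lemma sqint_dom f F : mfun_c f -> measurable_fun D F ->
  (forall x, D x -> csq (f x) <= F x) ->
  (\int[mu]_(x in D) (F x)%:E < +oo)%E -> sqint f.
Proof.
move=> mf mF leF ltF; case: (mf) => mr mi; split => //.
apply: le_lt_trans ltF; apply: ge0_le_integral => //.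
- by move=> x _; rewrite lee_fin csq_ge0.
- by apply/measurable_EFinP; exact: measurable_csq.
exact/measurable_EFinP.
Qed.

Lemma sqint_csq_integrable f : sqint f ->
  mu.-integrable D (EFin \o (fun x => csq (f x))).
Proof.
move=> [fr fi foo]; apply/integrableP; split.
  by apply/measurable_EFinP; exact: measurable_csq.
by under eq_integral do rewrite /= ger0_norm ?csq_ge0//.
Qed.

Lemma sqintD f g : sqint f -> sqint g -> sqint (fun x => f x + g x).
Proof.
move=> sf sg; have mf := sqint_mfun sf; have mg := sqint_mfun sg.
apply: (@sqint_dom _ (fun x => 2 * csq (f x) + 2 * csq (g x))).
- exact: mfun_cD.
- by apply: measurable_funD; apply: measurable_funM => //; exact: measurable_csq.
- by move=> x _; exact: csqD_le.
have /integrableP[_] : mu.-integrable D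
    (EFin \o (fun x => 2 * csq (f x) + 2 * csq (g x))).
  have := integrableD mD (integrableZl mD 2 (sqint_csq_integrable sf))
    (integrableZl mD 2 (sqint_csq_integrable sg)).
  by apply: eq_integrable => // x _.
apply: le_lt_trans; apply: ge0_le_integral => //.
- by move=> x _; rewrite lee_fin addr_ge0 // mulr_ge0 // csq_ge0.
- apply/measurable_EFinP.
  by apply: measurable_funD; apply: measurable_funM => //; exact: measurable_csq.
- apply: measurableT_comp => //; apply/measurable_EFinP.
  by apply: measurable_funD; apply: measurable_funM => //; exact: measurable_csq.
by move=> x _; rewrite lee_fin ler_norm.
Qed.

Lemma sqintN f : sqint f -> sqint (fun x => - f x).
Proof.
move=> [fr fi foo]; have [nr ni] := mfun_cN (conj fr fi); split => //.
by under eq_integral do rewrite csqN.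
Qed.

Lemma sqintJ f : sqint f -> sqint (fun x => conjc (f x)).
Proof.
move=> [fr fi foo]; have [nr ni] := mfun_cJ (conj fr fi); split => //.
by under eq_integral do rewrite csqJ.
Qed.

Lemma sqintM (W : T -> R[i]) (K : R) f : mfun_c W ->
  (forall x, D x -> csq (W x) <= K) -> sqint f ->
  sqint (fun x => W x * f x).
Proof.
move=> mW leK sf; have mf := sqint_mfun sf.
apply: (@sqint_dom _ (fun x => K * csq (f x))).
- exact: mfun_cM.
- by apply: measurable_funM => //; exact: measurable_csq.
- by move=> x Dx; rewrite csqM ler_wpM2r ?csq_ge0 ?leK.
have /integrableP[_] := integrableZl mD K (sqint_csq_integrable sf).
apply: le_lt_trans; apply: ge0_le_integral => //.
- move=> x Dx; rewrite lee_fin mulr_ge0 ?csq_ge0 //.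
  exact: le_trans (csq_ge0 (W x)) (leK _ Dx).
- by apply/measurable_EFinP; apply: measurable_funM => //; exact: measurable_csq.
- apply: measurableT_comp => //; apply/measurable_EFinP.
  by apply: measurable_funM => //; exact: measurable_csq.
by move=> x _; rewrite lee_fin ler_norm.
Qed.

Lemma sqint_bounded (K : R) f : (mu D < +oo)%E -> mfun_c f ->
  (forall x, D x -> csq (f x) <= K) -> sqint f.
Proof.
move=> fD mf leK; apply: (@sqint_dom _ (cst K)) => //.
rewrite (_ : \int[mu]_(x in D) _ = \int[mu]_(x in D) (cst K%:E x))%E //.
rewrite integral_cst //; case: (leP 0 K) => [K0|K0].
  by rewrite lte_mul_pinfty.
by apply: le_lt_trans (ltry 0); rewrite mule_le0_ge0 // lee_fin ltW.
Qed.

(** The product is dominated by |f|^2 + |g|^2. *)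
Lemma cintegrableM f g : sqint f -> sqint g -> cintegrable (fun x => f x * g x).
Proof.
move=> sf sg; have mf := sqint_mfun sf; have mg := sqint_mfun sg.
have [mr mi] := mfun_cM mf mg.
have iD : mu.-integrable D (EFin \o (fun x => csq (f x) + csq (g x))).
  have := integrableD mD (sqint_csq_integrable sf) (sqint_csq_integrable sg).
  by apply: eq_integrable => // x _.
have bnd (a b c e : R) : `|a * c - b * e| <= (a ^+ 2 + b ^+ 2) + (c ^+ 2 + e ^+ 2).
  rewrite ler_norml; apply/andP; split.
    by have := sqr_ge0 (a + c); have := sqr_ge0 (b - e); nra.
  by have := sqr_ge0 (a - c); have := sqr_ge0 (b + e); nra.
have pos x : 0 <= csq (f x) + csq (g x) by apply: addr_ge0; exact: csq_ge0.
split; apply: le_integrable iD => //; try exact/measurable_EFinP.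
  move=> x _; rewrite /comp lee_fin [leRHS]ger0_norm // Re_cmul.
  exact: bnd.
move=> x _; rewrite /comp lee_fin [leRHS]ger0_norm // Im_cmul.
have := bnd (complex.Re (f x)) (- complex.Im (f x)) (complex.Im (g x))
  (complex.Re (g x)).
by rewrite mulNr opprK sqrrN /csq [X in _ <= _ + X -> _]addrC.
Qed.

Lemma gintD f g : cintegrable f -> cintegrable g ->
  gint (fun x => f x + g x) = gint f + gint g.
Proof.
move=> [fr fi] [gr gi]; apply/eqP; rewrite eq_complex /=; apply/andP; split; apply/eqP.
  by under eq_Rintegral do rewrite Re_cadd; rewrite RintegralD.
by under eq_Rintegral do rewrite Im_cadd; rewrite RintegralD.
Qed.

Lemma RintegralN (F : T -> R) : mu.-integrable D (EFin \o F) ->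
  \int[mu]_(x in D) (- F x) = - \int[mu]_(x in D) F x.
Proof.
move=> iF; rewrite -mulN1r -RintegralZl //.
by apply: eq_Rintegral => x _; rewrite mulN1r.
Qed.

Lemma gintN f : cintegrable f -> gint (fun x => - f x) = - gint f.
Proof.
move=> [fr fi]; apply/eqP; rewrite eq_complex /=; apply/andP; split; apply/eqP.
  by under eq_Rintegral do rewrite Re_copp; rewrite RintegralN.
by under eq_Rintegral do rewrite Im_copp; rewrite RintegralN.
Qed.

Lemma gintJ f : cintegrable f -> gint (fun x => conjc (f x)) = conjc (gint f).
Proof.
move=> [fr fi]; apply/eqP; rewrite eq_complex /=; apply/andP; split; apply/eqP.
  by under eq_Rintegral do rewrite Re_conjc.
by under eq_Rintegral do rewrite Im_conjc; rewrite RintegralN.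
Qed.

Lemma eq_gint f g : (forall x, D x -> f x = g x) -> gint f = gint g.
Proof.
by move=> fg; congr (_ +i* _); apply: eq_Rintegral => x; rewrite inE => /fg ->.
Qed.

Lemma ae_eq_gint f g : mfun_c f -> mfun_c g ->
  {ae mu, forall x, D x -> f x = g x} -> gint f = gint g.
Proof.
move=> [fr fi] [gr gi] fg; congr (_ +i* _); congr fine;
  apply: ae_eq_integral => //; try exact/measurable_EFinP;
  by apply: filterS fg => x fgx Dx; rewrite /= (fgx Dx).
Qed.

End ComplexIntegral.
Section SquareLimits.
Context d (T : measurableType d) (R : realType) (mu : {measure set T -> \bar R}).
Variable D : set T.
Hypothesis mD : measurable D.

(** The squared distance of the sums is at most twice the sum of the squared
    distances, so a squeeze applies. *)
Lemma sqint_cvgD (f1 f2 : nat -> T -> R[i]) (g1 g2 : T -> R[i]) :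
  (forall n, sqint mu D (f1 n)) -> (forall n, sqint mu D (f2 n)) ->
  sqint mu D g1 -> sqint mu D g2 ->
  (fun n => \int[mu]_(x in D) (csq (f1 n x - g1 x))%:E)%E @ \oo --> 0%E ->
  (fun n => \int[mu]_(x in D) (csq (f2 n x - g2 x))%:E)%E @ \oo --> 0%E ->
  (fun n => \int[mu]_(x in D)
     (csq (f1 n x + f2 n x - (g1 x + g2 x)))%:E)%E @ \oo --> 0%E.
Proof.
move=> s1 s2 t1 t2 l1 l2.
have m1 n := measurable_csq (mfun_cD (sqint_mfun (s1 n))
  (mfun_cN (sqint_mfun t1))).
have m2 n := measurable_csq (mfun_cD (sqint_mfun (s2 n))
  (mfun_cN (sqint_mfun t2))).
have m n := measurable_csq (mfun_cD
  (mfun_cD (sqint_mfun (s1 n)) (sqint_mfun (s2 n)))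
  (mfun_cN (mfun_cD (sqint_mfun t1) (sqint_mfun t2)))).
pose a n := (\int[mu]_(x in D) (csq (f1 n x - g1 x))%:E)%E.
pose b n := (\int[mu]_(x in D) (csq (f2 n x - g2 x))%:E)%E.
apply: (@squeeze_cvge _ _ _ _ (cst 0%E) _ (fun n => 2%:E * (a n + b n))%E); last 2 first.
- exact: cvg_cst.
- rewrite -[X in _ --> X](mule0 2%:E); apply: cvgeZl => //.
  by rewrite -[X in _ --> X](adde0 0%E); apply: cvgeD.
apply: nearW => n; apply/andP; split.
  by apply: integral_ge0 => x _; rewrite lee_fin csq_ge0.
rewrite /a /b -ge0_integralD //; last 4 first.
- by move=> x _; rewrite lee_fin csq_ge0.
- exact/measurable_EFinP.
- by move=> x _; rewrite lee_fin csq_ge0.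
- exact/measurable_EFinP.
rewrite -ge0_integralZl //; last 2 first.
- apply/measurable_EFinP; apply: measurable_funD; [exact: m1|exact: m2].
- by move=> x _; rewrite lee_fin; apply: addr_ge0; exact: csq_ge0.
apply: ge0_le_integral => //.
- by move=> x _; rewrite lee_fin csq_ge0.
- by apply/measurable_EFinP; exact: m.
- apply/measurable_EFinP; apply: measurable_funM => //.
  by apply: measurable_funD; [exact: m1|exact: m2].
move=> x _; rewrite lee_fin mulrDr opprD addrACA; exact: csqD_le.
Qed.

End SquareLimits.
(** * Measurability and boundedness in the plane *)

Section Plane.
Variable R : realType.
Implicit Types D U : set (R * R).

Definition box (p : R * R) (r : R) : set (R * R) :=
  `](p.1 - r), (p.1 + r)[ `*` `](p.2 - r), (p.2 + r)[.

(** An open set is the union of the open squares with rational centre and radius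
    that it contains, and these are countably many measurable rectangles. *)
Lemma open_measurable_plane U : open U -> measurable U.
Proof.
move=> oU.
pose Q := [set q : rat * rat * rat |
  box (ratr q.1.1, ratr q.1.2) (ratr q.2) `<=` U].
have -> : U = \bigcup_q (if q \in Q then
    box (ratr q.1.1, ratr q.1.2) (ratr q.2) else set0).
  apply/seteqP; split=> x; last first.
    by case=> q _; case: ifPn => // /[!inE]; exact.
  move=> Ux; have /nbhs_ballP[e /= e0 eU] : nbhs x U by exact: open_nbhs_nbhs.
  have e20 : 0 < e / 2 by rewrite divr_gt0.
  have [r] := rat_in_itvoo e20; rewrite in_itv /= => /andP[r0 re].
  have [q1] := @rat_in_itvoo R (x.1 - ratr r) (x.1 + ratr r) ltac:(lra).
  have [q2] := @rat_in_itvoo R (x.2 - ratr r) (x.2 + ratr r) ltac:(lra).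
  rewrite !in_itv /= => /andP[a1 a2] /andP[b1 b2].
  exists ((q1, q2), r) => //; rewrite ifT; last first.
    rewrite inE /Q /= => y [] /=; rewrite !in_itv /= => /andP[y1 y2] /andP[y3 y4].
    apply: eU; split; rewrite /= /ball /= ltr_norml; apply/andP; split; lra.
  by split; rewrite /= in_itv /=; apply/andP; split; lra.
apply: countable_bigcupT_measurable; first exact: countableP.
by move=> q; case: ifP => // _; apply: measurableX.
Qed.

Lemma closed_measurable_plane U : closed U -> measurable U.
Proof.
by move=> cU; rewrite -[U]setCK; apply: measurableC; apply: open_measurable_plane;
  exact: closed_openC.
Qed.

Lemma measurable_bd U : measurable (bd U).
Proof.
apply: measurableD.
  by apply: closed_measurable_plane; exact: closed_closure.
by apply: open_measurable_plane; exact: open_interior.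
Qed.

Lemma continuous_measurable_plane (f : R * R -> R) D : continuous f ->
  measurable D -> measurable_fun D f.
Proof.
move=> cf mD; apply: (@measurable_funS _ _ _ _ setT) => //.
apply: (measurability _ (RGenOpens.measurableE R)).
move=> _ [_ [a [b ->] <-]]; rewrite setTI; apply: open_measurable_plane.
by apply: open_comp => // x _; exact: cf.
Qed.

Lemma bounded_plane_box D : bounded_set D -> exists2 M : R, 0 < M &
  D `<=` `[- M, M] `*` `[- M, M].
Proof.
move=> [M [Mr bM]]; exists (`|M| + 1); first by rewrite ltr_pwDr.
move=> x Dx; have := bM (`|M| + 1) _ x Dx; rewrite (le_lt_trans (ler_norm M)) ?ltrDl//.
move=> /(_ isT); rewrite /= prod_normE ge_max => /andP[].
by rewrite !ler_norml => h1 h2; split; rewrite /= in_itv.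
Qed.

Lemma bounded_plane_finite D : bounded_set D -> measurable D ->
  (area D < +oo)%E.
Proof.
move=> /bounded_plane_box[M M0 DM] mD.
apply: (@le_lt_trans _ _ (area (`[- M, M] `*` `[- M, M]))).
  by apply: le_measure; rewrite ?inE //; exact: measurableX.
rewrite product_measure1E //=.
by rewrite lebesgue_measure_itv /=; case: ifP; rewrite ?mule0 // -EFinM ltry.
Qed.

Lemma bounded_plane_continuous D (f : R * R -> R) : bounded_set D ->
  continuous f -> exists K, forall x, D x -> `|f x| <= K.
Proof.
move=> /bounded_plane_box[M M0 DM] cf.
have cB : compact (`[- M, M] `*` `[- M, M] : set (R * R)).
  by apply: compact_setX; exact: segment_compact.
have /compact_bounded[K [_ bK]] : compact (f @` (`[- M, M] `*` `[- M, M])).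
  by apply: continuous_compact => //; exact: continuous_subspaceT.
exists (K + 1) => x Dx; apply: (bK (K + 1)); first by rewrite ltrDl.
by exists x => //; exact: DM.
Qed.

End Plane.
(** * Smooth functions *)

Section SmoothFunctions.
Variable R : realType.
Implicit Types f g : R * R -> R.

Lemma CnD n f g : Cn n f -> Cn n g -> Cn n (fun x => f x + g x).
Proof.
elim: n f g => [|n IH] f g; first by
  move=> cf cg x; apply: continuousD; [exact: cf|exact: cg].
move=> [cf df f1 f2] [cg dg g1 g2]; split.
- by move=> x; apply: continuousD; [exact: cf|exact: cg].
- by move=> x; have [a b] := df x; have [a' b'] := dg x; split; exact: derivableD.
- rewrite (_ : (fun x => _) =
    (fun x => 'D_((1, 0) : plane R) f x + 'D_((1, 0) : plane R) g x)).
    exact: IH.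
  by apply/funext => x; rewrite deriveD; [|exact: (df x).1|exact: (dg x).1].
rewrite (_ : (fun x => _) =
    (fun x => 'D_((0, 1) : plane R) f x + 'D_((0, 1) : plane R) g x)).
  exact: IH.
by apply/funext => x; rewrite deriveD; [|exact: (df x).2|exact: (dg x).2].
Qed.

Lemma CnN n f : Cn n f -> Cn n (fun x => - f x).
Proof.
elim: n f => [|n IH] f; first by move=> cf x; apply: continuousN; exact: cf.
move=> [cf df f1 f2]; split.
- by move=> x; apply: continuousN; exact: cf.
- by move=> x; have [a b] := df x; split; exact: derivableN.
- rewrite (_ : (fun x => _) = (fun x => - 'D_((1, 0) : plane R) f x)); first exact: IH.
  by apply/funext => x; rewrite deriveN; [|exact: (df x).1].
rewrite (_ : (fun x => _) = (fun x => - 'D_((0, 1) : plane R) f x)); first exact: IH.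
by apply/funext => x; rewrite deriveN; [|exact: (df x).2].
Qed.

Lemma Cn_0 n : Cn n (fun=> 0 : R).
Proof.
elim: n => [|n IH]; first by move=> x; exact: cvg_cst.
have d0 (v : R * R) : (fun x => 'D_v (fun=> 0 : R) x) = (fun=> 0).
  by apply/funext => x; rewrite derive_cst.
by split=> //; [move=> x; exact: cvg_cst|rewrite d0|rewrite d0].
Qed.

Lemma smooth_derivable f : smooth f ->
  forall x, derivable f x (1, 0) /\ derivable f x (0, 1).
Proof. by move=> /(_ 1%N) /= []. Qed.

Lemma smoothD f g : smooth f -> smooth g -> smooth (fun x => f x + g x).
Proof. by move=> sf sg n; exact: CnD. Qed.

Lemma smoothN f : smooth f -> smooth (fun x => - f x).
Proof. by move=> sf n; exact: CnN. Qed.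

Lemma sob_ofD (p q p' q' : R * R -> R) :
  smooth p -> smooth q -> smooth p' -> smooth q' ->
  sob_of (fun x => p x + p' x) (fun x => q x + q' x) =
    sobD (sob_of p q) (sob_of p' q').
Proof.
move=> /smooth_derivable dp /smooth_derivable dq /smooth_derivable dp'
  /smooth_derivable dq'.
rewrite /sob_of /sobD /=; congr Sob; apply/funext => x;
  have [p1 p2] := dp x; have [q1 q2] := dq x;
  have [p1' p2'] := dp' x; have [q1' q2'] := dq' x.
  rewrite -[RHS]/((_ + _) +i* (_ + _)); congr (_ +i* _).
    exact: (deriveD p1 p1').
  exact: (deriveD q1 q1').
rewrite -[RHS]/((_ + _) +i* (_ + _)); congr (_ +i* _).
  exact: (deriveD p2 p2').
exact: (deriveD q2 q2').
Qed.

Lemma mulN1c (z : R[i]) : - 1 * z = - z.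
Proof. exact: mulN1r. Qed.

Lemma sob_ofN (p q : R * R -> R) : smooth p -> smooth q ->
  sob_of (fun x => - p x) (fun x => - q x) = sobZ (- 1) (sob_of p q).
Proof.
move=> /smooth_derivable dp /smooth_derivable dq.
rewrite /sob_of /sobZ; congr Sob; apply/funext => x /=;
  have [p1 p2] := dp x; have [q1 q2] := dq x; rewrite mulN1c.
- by [].
- rewrite -[RHS]/((- _) +i* (- _)); congr (_ +i* _).
    exact: (deriveN p1).
  exact: (deriveN q1).
- rewrite -[RHS]/((- _) +i* (- _)); congr (_ +i* _).
    exact: (deriveN p2).
  exact: (deriveN q2).
- by [].
Qed.

Lemma sob_ofJ (p q : R * R -> R) : smooth q ->
  sob_of p (fun x => - q x) = sobC (sob_of p q).
Proof.
move=> /smooth_derivable dq.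
rewrite /sob_of /sobC /=; congr Sob; apply/funext => x; have [q1 q2] := dq x.
  by congr (_ +i* _); exact: (deriveN q1).
by congr (_ +i* _); exact: (deriveN q2).
Qed.

End SmoothFunctions.

(** * Stability of H^1 under sums and conjugation *)

Section SobolevSpace.
Variables (R : realType) (D : set (R * R)) (ss : seq (side R)).
Hypotheses (mD : measurable D) (bD : bounded_set D).
Implicit Types u v : sob R.

Let mI : measurable (I01 R). Proof. exact: measurable_itv. Qed.

Lemma inL2D f g : inL2 D f -> inL2 D g -> inL2 D (fun x => f x + g x).
Proof. exact: (sqintD (mu := area) mD). Qed.

Lemma inL2_sideD (s : side R) f g : inL2_side s f -> inL2_side s g ->
  inL2_side s (fun x => f x + g x).
Proof. exact: (sqintD (mu := lebesgue_measure) mI). Qed.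

Lemma sobL2D u v : sobL2 D ss u -> sobL2 D ss v -> sobL2 D ss (sobD u v).
Proof.
move=> [u0 u1 u2 ut] [v0 v1 v2 vt]; split; [exact: inL2D|exact: inL2D|
  exact: inL2D|move=> s hs].
by apply: inL2_sideD; [exact: ut|exact: vt].
Qed.

Lemma inL2N f : inL2 D f -> inL2 D (fun x => - 1 * f x).
Proof.
by move=> sf; under [fun x => _]eq_fun do rewrite mulN1c;
  exact: (sqintN (mu := area)).
Qed.

Lemma inL2_sideN (s : side R) f : inL2_side s f ->
  inL2_side s (fun x => - 1 * f x).
Proof.
by move=> sf; under [fun x => _]eq_fun do rewrite mulN1c;
  exact: (sqintN (mu := lebesgue_measure)).
Qed.

Lemma sobL2N u : sobL2 D ss u -> sobL2 D ss (sobZ (- 1) u).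
Proof.
move=> [u0 u1 u2 ut]; split; [exact: inL2N|exact: inL2N|exact: inL2N|move=> s hs].
by apply: inL2_sideN; exact: ut.
Qed.

Lemma inL2J f : inL2 D f -> inL2 D (fun x => conjc (f x)).
Proof. exact: (sqintJ (mu := area)). Qed.

Lemma inL2_sideJ (s : side R) f : inL2_side s f ->
  inL2_side s (fun x => conjc (f x)).
Proof. exact: (sqintJ (mu := lebesgue_measure)). Qed.

Lemma sobL2J u : sobL2 D ss u -> sobL2 D ss (sobC u).
Proof.
move=> [u0 u1 u2 ut]; split; [exact: inL2J|exact: inL2J|exact: inL2J|move=> s hs].
by apply: inL2_sideJ; exact: ut.
Qed.

Lemma sobL20 : sobL2 D ss (sob0 R).
Proof.
have s0 d (T : measurableType d) (mu : {measure set T -> \bar R}) (A : set T) :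
    sqint mu A (fun=> 0).
  split; [exact: measurable_cst|exact: measurable_cst|].
  by rewrite integral0_eq // => x _; rewrite /csq /= !expr0n /= addr0.
by split=> [|||s _]; [exact: (s0 _ _ area)|exact: (s0 _ _ area)|
  exact: (s0 _ _ area)|exact: (s0 _ _ lebesgue_measure)].
Qed.

Lemma sqint_continuous (f : R * R -> R) : continuous f ->
  sqint area D (fun x => (f x)%:C).
Proof.
move=> cf; have [K fK] := bounded_plane_continuous bD cf.
apply: (sqint_bounded (mu := area) mD (K := K ^+ 2)).
- exact: bounded_plane_finite.
- by split; [exact: continuous_measurable_plane|exact: measurable_cst].
move=> x Dx; rewrite /csq /= expr0n addr0 -real_normK ?num_real // lerXn2r ?nnegrE //.
  exact: le_trans (fK _ Dx).
exact: fK.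
Qed.

Lemma test_function_sqint phi : test_function D phi ->
  [/\ sqint area D (fun x => (phi x)%:C),
      sqint area D (fun x => ('D_((1, 0) : plane R) phi x)%:C)
    & sqint area D (fun x => ('D_((0, 1) : plane R) phi x)%:C)].
Proof.
move=> [sp _ _]; have [c0 _ c1 c2] := sp 1%N.
by split; apply: sqint_continuous.
Qed.

(** The integrals against a test function split because the test function and
    its derivatives are square integrable on the bounded domain. *)
Lemma weak_gradientD u v : sobL2 D ss u -> sobL2 D ss v ->
  weak_gradient D u -> weak_gradient D v -> weak_gradient D (sobD u v).
Proof.
move=> [u0 u1 u2 _] [v0 v1 v2 _] gu gv phi tp.
have [p0 p1 p2] := test_function_sqint tp.
have [gux guy] := gu _ tp; have [gvx gvy] := gv _ tp.
have addE f g h : inL2 D f -> inL2 D g -> sqint area D h ->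
    cint D (fun x => (f x + g x) * h x) =
    cint D (fun x => f x * h x) + cint D (fun x => g x * h x).
  move=> sf sg sh; transitivity (gint area D (fun x => f x * h x + g x * h x)).
    by apply: (eq_gint area) => x _; rewrite mulrDl.
  exact: (gintD (mu := area) mD (cintegrableM (mu := area) mD sf sh)
    (cintegrableM (mu := area) mD sg sh)).
split.
  by rewrite (addE _ _ _ u0 v0 p1) (addE _ _ _ u1 v1 p0) gux gvx opprD.
by rewrite (addE _ _ _ u0 v0 p2) (addE _ _ _ u2 v2 p0) guy gvy opprD.
Qed.

Lemma weak_gradientN u : sobL2 D ss u ->
  weak_gradient D u -> weak_gradient D (sobZ (- 1) u).
Proof.
move=> [u0 u1 u2 _] gu phi tp.
have [p0 p1 p2] := test_function_sqint tp; have [gux guy] := gu _ tp.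
have oppE f h : inL2 D f -> sqint area D h ->
    cint D (fun x => - 1 * f x * h x) = - cint D (fun x => f x * h x).
  move=> sf sh; transitivity (gint area D (fun x => - (f x * h x))).
    by apply: (eq_gint area) => x _; rewrite mulN1c mulNr.
  exact: (gintN (mu := area) mD (cintegrableM (mu := area) mD sf sh)).
split.
  by rewrite (oppE _ _ u0 p1) (oppE _ _ u1 p0) gux.
by rewrite (oppE _ _ u0 p2) (oppE _ _ u2 p0) guy.
Qed.

Lemma weak_gradientJ u : sobL2 D ss u ->
  weak_gradient D u -> weak_gradient D (sobC u).
Proof.
move=> [u0 u1 u2 _] gu phi tp.
have [p0 p1 p2] := test_function_sqint tp; have [gux guy] := gu _ tp.
have conjE f (h : R * R -> R) : inL2 D f -> sqint area D (fun x => (h x)%:C) ->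
    cint D (fun x => conjc (f x) * (h x)%:C) = conjc (cint D (fun x => f x * (h x)%:C)).
  move=> sf sh.
  rewrite -[RHS](gintJ (mu := area) mD (cintegrableM (mu := area) mD sf sh)).
  by apply: (eq_gint area) => x _; rewrite conjc_mul; congr (_ * _);
    exact/esym/conjc_ofreal.
split.
  by rewrite (conjE _ _ u0 p1) (conjE _ _ u1 p0) gux conjc_opp.
by rewrite (conjE _ _ u0 p2) (conjE _ _ u2 p0) guy conjc_opp.
Qed.

Lemma weak_gradient0 : weak_gradient D (sob0 R).
Proof.
move=> phi _; have z h : cint D (fun x : R * R => 0 * h x) = 0.
  by rewrite /cint /Rintegral !integral0_eq // => x _; rewrite mul0r.
by split; rewrite /sob0 /= !z oppr0.
Qed.

(** Sums of approximating smooth functions approximate the sum, in the domain and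
    on each side. *)
Lemma has_traceD u v : sobL2 D ss u -> sobL2 D ss v ->
  has_trace D ss u -> has_trace D ss v -> has_trace D ss (sobD u v).
Proof.
move=> [u0 u1 u2 ut] [v0 v1 v2 vt] [p [q]]; cbv zeta.
move=> [sw l0 l1 l2 lt] [p' [q']]; cbv zeta => -[sw' l0' l1' l2' lt'].
pose P n x := p n x + p' n x; pose Q n x := q n x + q' n x.
have E : (fun n => sob_of (P n) (Q n)) =
    (fun n => sobD (sob_of (p n) (q n)) (sob_of (p' n) (q' n))).
  apply/funext => n; have [? ? _] := sw n; have [? ? _] := sw' n.
  exact: sob_ofD.
exists P, Q; rewrite E; cbv zeta beta; split.
- move=> n; have [? ? ?] := sw n; have [? ? ?] := sw' n.
  by split; [exact: smoothD|exact: smoothD|exact: sobL2D].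
- by apply: (sqint_cvgD (mu := area) (f1 := fun n => fn (sob_of (p n) (q n)))
    (f2 := fun n => fn (sob_of (p' n) (q' n))) mD _ _ u0 v0 l0 l0') => n;
    [have [_ _ [a _ _ _]] := sw n; exact: a|
      have [_ _ [a _ _ _]] := sw' n; exact: a].
- by apply: (sqint_cvgD (mu := area) (f1 := fun n => dx (sob_of (p n) (q n)))
    (f2 := fun n => dx (sob_of (p' n) (q' n))) mD _ _ u1 v1 l1 l1') => n;
    [have [_ _ [_ a _ _]] := sw n; exact: a|
      have [_ _ [_ a _ _]] := sw' n; exact: a].
- by apply: (sqint_cvgD (mu := area) (f1 := fun n => dy (sob_of (p n) (q n)))
    (f2 := fun n => dy (sob_of (p' n) (q' n))) mD _ _ u2 v2 l2 l2') => n;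
    [have [_ _ [_ _ a _]] := sw n; exact: a|
      have [_ _ [_ _ a _]] := sw' n; exact: a].
move=> s hs; apply: (sqint_cvgD (mu := lebesgue_measure)
    (f1 := fun n t => tr (sob_of (p n) (q n)) (spt s t))
    (f2 := fun n t => tr (sob_of (p' n) (q' n)) (spt s t)) mI _ _
    (ut _ hs) (vt _ hs) (lt _ hs) (lt' _ hs)) => n.
  by have [_ _ [_ _ _]] := sw n; exact.
by have [_ _ [_ _ _]] := sw' n; exact.
Qed.

Lemma has_traceN u : has_trace D ss u -> has_trace D ss (sobZ (- 1) u).
Proof.
move=> [p [q]]; cbv zeta => -[sw l0 l1 l2 lt].
pose P n x := - p n x; pose Q n x := - q n x.
have E : (fun n => sob_of (P n) (Q n)) =
    (fun n => sobZ (- 1) (sob_of (p n) (q n))).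
  by apply/funext => n; have [? ? _] := sw n; exact: sob_ofN.
have K (z w : R[i]) : csq (- 1 * z - - 1 * w) = csq (z - w).
  by rewrite !mulN1c -opprD csqN.
have KE d (T : measurableType d) (mu : {measure set T -> \bar R}) (A : set T)
    (f : nat -> T -> R[i]) g :
    (fun n => \int[mu]_(x in A) (csq (f n x - g x))%:E)%E @ \oo --> 0%E ->
    (fun n => \int[mu]_(x in A) (csq (- 1 * f n x - - 1 * g x))%:E)%E
      @ \oo --> 0%E.
  by under [in X in _ -> X]eq_fun do under eq_integral do rewrite K.
exists P, Q; rewrite E; cbv zeta beta; split.
- move=> n; have [? ? ?] := sw n.
  by split; [exact: smoothN|exact: smoothN|exact: sobL2N].
- exact: (KE _ _ area D (fun n => fn (sob_of (p n) (q n))) (fn u) l0).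
- exact: (KE _ _ area D (fun n => dx (sob_of (p n) (q n))) (dx u) l1).
- exact: (KE _ _ area D (fun n => dy (sob_of (p n) (q n))) (dy u) l2).
move=> s hs; exact: (KE _ _ lebesgue_measure (I01 R)
  (fun n t => tr (sob_of (p n) (q n)) (spt s t)) (fun t => tr u (spt s t))
  (lt _ hs)).
Qed.

Lemma has_traceJ u : has_trace D ss u -> has_trace D ss (sobC u).
Proof.
move=> [p [q]]; cbv zeta => -[sw l0 l1 l2 lt].
pose Q n x := - q n x.
have E : (fun n => sob_of (p n) (Q n)) = (fun n => sobC (sob_of (p n) (q n))).
  by apply/funext => n; have [? ? _] := sw n; exact: sob_ofJ.
have K (z w : R[i]) : csq (conjc z - conjc w) = csq (z - w).
  by rewrite -conjc_opp -conjc_add csqJ.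
have KE d (T : measurableType d) (mu : {measure set T -> \bar R}) (A : set T)
    (f : nat -> T -> R[i]) g :
    (fun n => \int[mu]_(x in A) (csq (f n x - g x))%:E)%E @ \oo --> 0%E ->
    (fun n => \int[mu]_(x in A) (csq (conjc (f n x) - conjc (g x)))%:E)%E
      @ \oo --> 0%E.
  by under [in X in _ -> X]eq_fun do under eq_integral do rewrite K.
exists p, Q; rewrite E; cbv zeta beta; split.
- move=> n; have [? ? ?] := sw n.
  by split; [|exact: smoothN|exact: sobL2J].
- exact: (KE _ _ area D (fun n => fn (sob_of (p n) (q n))) (fn u) l0).
- exact: (KE _ _ area D (fun n => dx (sob_of (p n) (q n))) (dx u) l1).
- exact: (KE _ _ area D (fun n => dy (sob_of (p n) (q n))) (dy u) l2).
move=> s hs; exact: (KE _ _ lebesgue_measure (I01 R)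
  (fun n t => tr (sob_of (p n) (q n)) (spt s t)) (fun t => tr u (spt s t))
  (lt _ hs)).
Qed.

Lemma has_trace0 : has_trace D ss (sob0 R).
Proof.
have s0 : smooth (fun=> 0 : R) by move=> n; exact: Cn_0.
have E : sob_of (fun=> 0) (fun=> 0) = sob0 R.
  by rewrite /sob_of /sob0; congr Sob; apply/funext => x; rewrite !derive_cst.
have K d (T : measurableType d) (mu : {measure set T -> \bar R}) (A : set T) :
    (\int[mu]_(x in A) (csq (0 - 0 : R[i]))%:E)%E @[n --> \oo] --> 0%E.
  rewrite integral0_eq; first exact: cvg_cst.
  by move=> x _; rewrite /csq /= subr0 !expr0n /= addr0.
pose Z (n : nat) (x : R * R) : R := 0.
exists Z, Z; have -> : (fun n => sob_of (Z n) (Z n)) = (fun=> sob0 R).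
  by apply/funext => n; exact: E.
cbv zeta beta; split=> [n||||s hs].
- by split; [exact: s0|exact: s0|exact: sobL20].
- exact: (K _ _ area).
- exact: (K _ _ area).
- exact: (K _ _ area).
exact: (K _ _ lebesgue_measure).
Qed.

Lemma H1D u v : H1 D ss u -> H1 D ss v -> H1 D ss (sobD u v).
Proof.
move=> [su gu tu] [sv gv tv]; split; [exact: sobL2D|exact: weak_gradientD|].
exact: has_traceD.
Qed.

Lemma H1N u : H1 D ss u -> H1 D ss (sobZ (- 1) u).
Proof.
by move=> [su gu tu]; split; [exact: sobL2N|exact: weak_gradientN|exact: has_traceN].
Qed.

Lemma H1J u : H1 D ss u -> H1 D ss (sobC u).
Proof.
by move=> [su gu tu]; split; [exact: sobL2J|exact: weak_gradientJ|exact: has_traceJ].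
Qed.

Lemma H10 : H1 D ss (sob0 R).
Proof. by split; [exact: sobL20|exact: weak_gradient0|exact: has_trace0]. Qed.

End SobolevSpace.
(** * Weighted sesquilinear forms *)

Lemma ae_imply2 d (T : measurableType d) (R : realType)
    (mu : {measure set T -> \bar R}) (Q1 Q2 Q : T -> Prop) :
  {ae mu, forall x, Q1 x} -> {ae mu, forall x, Q2 x} ->
  (forall x, Q1 x -> Q2 x -> Q x) -> {ae mu, forall x, Q x}.
Proof. by move=> h1 h2 h; apply: filterS2 h1 h2. Qed.

Lemma ae_imply d (T : measurableType d) (R : realType)
    (mu : {measure set T -> \bar R}) (Q1 Q : T -> Prop) :
  {ae mu, forall x, Q1 x} ->
  (forall x, Q1 x -> Q x) -> {ae mu, forall x, Q x}.
Proof. by move=> h1 h; apply: filterS h1. Qed.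

Lemma aeT d (T : measurableType d) (R : realType)
    (mu : {measure set T -> \bar R}) (Q : T -> Prop) :
  (forall x, Q x) -> {ae mu, forall x, Q x}.
Proof. by move=> h; apply: nearW. Qed.

Section WeightedForm.
Context d (T : measurableType d) (R : realType) (mu : {measure set T -> \bar R}).
Variable D : set T.
Hypothesis mD : measurable D.
Implicit Types f g W : T -> R[i].

(** Each term of the Helmholtz form is of this kind, with a bounded weight:
    A or V^2 in the domain, and an imaginary weight on the sides. *)
Definition wform W f g : R[i] := gint mu D (fun x => W x * f x * conjc (g x)).

Lemma wform_sym W f g :
  wform W f (fun x => conjc (g x)) = wform W g (fun x => conjc (f x)).
Proof. by apply: eq_gint => x _ /=; rewrite !conjc_conjc mulrAC. Qed.

Variables (W : T -> R[i]) (K : R).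
Hypotheses (mW : mfun_c D W) (leK : forall x, D x -> csq (W x) <= K).

Lemma wform_integrable f g : sqint mu D f -> sqint mu D g ->
  cintegrable mu D (fun x => W x * f x * conjc (g x)).
Proof.
by move=> sf sg; apply: cintegrableM => //; [exact: sqintM leK sf|exact: sqintJ].
Qed.

Lemma wformDl f f' g : sqint mu D f -> sqint mu D f' -> sqint mu D g ->
  wform W (fun x => f x + f' x) g = wform W f g + wform W f' g.
Proof.
move=> sf sf' sg; rewrite /wform.
rewrite -(gintD mD (wform_integrable sf sg) (wform_integrable sf' sg)).
by apply: eq_gint => x _; rewrite mulrDr mulrDl.
Qed.

Lemma wformNl f g : sqint mu D f -> sqint mu D g ->
  wform W (fun x => - 1 * f x) g = - wform W f g.
Proof.
move=> sf sg; rewrite /wform -(gintN mD (wform_integrable sf sg)).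
by apply: eq_gint => x _; rewrite mulN1c mulrN mulNr.
Qed.

Lemma eq_wform_ae f f' g : sqint mu D f -> sqint mu D f' -> sqint mu D g ->
  {ae mu, forall x, D x -> f x = f' x} -> wform W f g = wform W f' g.
Proof.
move=> sf sf' sg ff'; apply: ae_eq_gint => //.
- apply: mfun_cM; [apply: mfun_cM => //; exact: sqint_mfun sf|].
  exact: (mfun_cJ (sqint_mfun sg)).
- apply: mfun_cM; [apply: mfun_cM => //; exact: sqint_mfun sf'|].
  exact: (mfun_cJ (sqint_mfun sg)).
by apply: filterS ff' => x e Dx; rewrite e.
Qed.

End WeightedForm.

Section RealWeight.
Context d (T : measurableType d) (R : realType) (mu : {measure set T -> \bar R}).
Variable D : set T.
Hypothesis mD : measurable D.
Implicit Types (f : T -> R[i]) (w : T -> R).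

Lemma Re_wform_real w f : complex.Re (wform mu D (fun x => (w x)%:C) f f) =
  \int[mu]_(x in D) (w x * csq (f x)).
Proof.
apply: eq_Rintegral => x _; case: (f x) => a b; rewrite /csq /=; ring.
Qed.

Lemma Re_wform_imaginary w f :
  complex.Re (wform mu D (fun x => 0 +i* w x) f f) = 0.
Proof.
rewrite /wform /gint /= /Rintegral integral0_eq // => x _; congr EFin.
by case: (f x) => a b /=; ring.
Qed.

Lemma integrable_wcsq w (K : R) f : measurable_fun D w ->
  (forall x, D x -> `|w x| <= K) -> sqint mu D f ->
  mu.-integrable D (EFin \o (fun x => w x * csq (f x))).
Proof.
move=> mw wK sf.
apply: (le_integrable mD _ _ (integrableZl mD K (sqint_csq_integrable sf))) => //.
  apply/measurable_EFinP; apply: measurable_funM => //.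
  exact: measurable_csq (sqint_mfun sf).
move=> x Dx; rewrite -EFinM /comp lee_fin [leRHS]ger0_norm.
  by rewrite normrM [X in _ * X]ger0_norm ?csq_ge0 // ler_wpM2r ?csq_ge0 // wK.
by rewrite mulr_ge0 ?csq_ge0 // (le_trans (normr_ge0 (w x)) (wK x Dx)).
Qed.

Lemma Rintegral_lin3 (f1 f2 f3 : T -> R) (c : R) :
  mu.-integrable D (EFin \o f1) -> mu.-integrable D (EFin \o f2) ->
  mu.-integrable D (EFin \o f3) ->
  \int[mu]_(x in D) (f1 x + f2 x + c * f3 x) =
  \int[mu]_(x in D) f1 x + \int[mu]_(x in D) f2 x + c * \int[mu]_(x in D) f3 x.
Proof.
move=> i1 i2 i3; rewrite -(RintegralZl _ mD i3) -(RintegralD mD i1 i2) -RintegralD //.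
  by have := integrableD mD i1 i2; apply: eq_integrable.
by have := integrableZl mD c i3; apply: eq_integrable.
Qed.

End RealWeight.
(** * The Helmholtz form *)

Section Helmholtz.
Variables (R : realType) (P : problem R).
Hypothesis hP : helmholtz_data P.
Implicit Types u v : sob R.

Local Notation O := (dom P).
Local Notation L2 := (sobL2 (dom P) (all_sides P)).

Lemma open_dom : open O. Proof. by case: hP => -[]. Qed.

Lemma bounded_dom : bounded_set O. Proof. by case: hP => -[]. Qed.

Lemma measurable_dom : measurable O.
Proof. exact: open_measurable_plane open_dom. Qed.

Lemma sqint_fn u : L2 u -> sqint area O (fn u). Proof. by case. Qed.

Lemma sqint_dx u : L2 u -> sqint area O (dx u). Proof. by case. Qed.

Lemma sqint_dy u : L2 u -> sqint area O (dy u). Proof. by case. Qed.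

Lemma sqint_tr u (s : side R) : L2 u -> s \in bsides P ->
  sqint lebesgue_measure (I01 R) (fun t => tr u (spt s t)).
Proof. by case=> _ _ _ h; rewrite mem_filter => /andP[_ /h]. Qed.

Lemma inH_sobL2 u : inH P u -> L2 u. Proof. by move=> [[]]. Qed.

Lemma inHD u v : inH P u -> inH P v -> inH P (sobD u v).
Proof.
move=> [hu tu] [hv tv]; split; first exact: (H1D measurable_dom bounded_dom).
move=> s hs; apply: (ae_imply2 (mu := lebesgue_measure) (tu s hs) (tv s hs)).
move=> t e1 e2 It gt /=.
by rewrite (e1 It gt) (e2 It gt) addr0.
Qed.

Lemma inHN u : inH P u -> inH P (sobZ (- 1) u).
Proof.
move=> [hu tu]; split; first exact: (H1N measurable_dom bounded_dom).
move=> s hs; apply: (ae_imply (mu := lebesgue_measure) (tu s hs)).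
by move=> t e1 It gt /=; rewrite (e1 It gt) mulr0.
Qed.

Lemma inHB u v : inH P u -> inH P v -> inH P (sobB u v).
Proof. by move=> hu hv; apply: inHD => //; exact: inHN. Qed.

Lemma inHJ u : inH P u -> inH P (sobC u).
Proof.
move=> [hu tu]; split; first exact: (H1J measurable_dom bounded_dom).
move=> s hs; apply: (ae_imply (mu := lebesgue_measure) (tu s hs)).
by move=> t e1 It gt /=; rewrite (e1 It gt) /= oppr0.
Qed.

Lemma inH_sob0 : inH P (sob0 R).
Proof.
split; first exact: H10.
by move=> s hs; apply: (aeT lebesgue_measure).
Qed.

Definition weightA (x : R * R) : R[i] := (cA P x)%:C.

Definition weightV (x : R * R) : R[i] := (cV P x ^+ 2)%:C.

(** The boundary term has the weight i times this real function, so that it does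
    not contribute to the real part of a(u, u). *)
Definition impedance (x : R * R) : R :=
  if x \in (GammaN P `|` GammaR P) `&` bd O
  then if x \in GammaR P then kk P * cbeta P x else 0 else 0.

(** Since beta is measurable on GammaR only, the function is recognized as the
    zero extension of k beta from a measurable subset of GammaR. *)
Lemma measurable_impedance : measurable_fun setT impedance.
Proof.
have [_ [_ _ mG _] _ [_ _ mb] _] := hP.
have -> : impedance = (fun x => kk P * cbeta P x) \_ (GammaR P `&` bd O).
  apply/funext => x; rewrite /impedance patchE.
  have [xR|xR] := boolP (x \in GammaR P); last first.
    rewrite if_same ifF //; apply/negbTE; apply: contra xR.
    by rewrite !inE => -[].
  rewrite inE in xR; congr (if _ then _ else _).
  by apply/idP/idP; rewrite !inE => -[? ?]; split=> //; right.
apply/(measurable_restrictT _ _).1 => //.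
  by apply: measurableI => //; exact: measurable_bd.
apply: measurable_funM => //.
by apply: measurable_funS mb => //; exact: subIsetl.
Qed.

Lemma measurable_spt (s : side R) : measurable_fun setT (spt s).
Proof.
apply/measurable_fun_pairP; split; apply: continuous_measurable_fun => t;
  by apply: cvgD; apply: cvgMr_tmp;
    [apply: cvgB; [exact: cvg_cst|exact: cvg_id]|exact: cvg_id].
Qed.

Lemma weightA_ok : mfun_c O weightA /\ forall x, O x -> csq (weightA x) <= Amax P ^+ 2.
Proof.
have [_ _ _ [mA _ _] [[_ A0 _ _] [bA _ _]]] := hP.
split; first by split.
move=> x Ox; have /andP[a1 a2] := bA _ Ox.
have c0 : 0 <= cA P x by rewrite (le_trans _ a1) // ltW.
by rewrite /csq /= expr0n addr0 lerXn2r // nnegrE // (le_trans c0).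
Qed.

Lemma weightV_ok : mfun_c O weightV /\
  forall x, O x -> csq (weightV x) <= (Vmax P ^+ 2) ^+ 2.
Proof.
have [_ _ _ [_ mV _] [[_ _ _ V0] [_ _ bV]]] := hP.
split; first by split => //; exact: measurable_funX.
move=> x Ox; have /andP[a1 a2] := bV _ Ox.
have c0 : 0 <= cV P x by rewrite (le_trans _ a1) // ltW.
have M0 := le_trans c0 a2.
by rewrite /csq /= expr0n addr0; do 2 rewrite lerXn2r ?nnegrE ?exprn_ge0 //.
Qed.

Lemma weightI_ok (s : side R) :
  mfun_c (I01 R) (fun t => 0 +i* impedance (spt s t)) /\
  forall t, I01 R t -> csq (0 +i* impedance (spt s t)) <= (kk P * betamax P) ^+ 2.
Proof.
have [_ _ _ _ [[k0 _ b0 _] [_ bb _]]] := hP.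
split.
  split; first exact: measurable_cst.
  apply: (@measurable_funS _ _ _ _ setT) => //.
  exact: (measurableT_comp measurable_impedance (measurable_spt s)).
move=> t _; rewrite /csq /= expr0n add0r /impedance.
case: ifP => _; last by rewrite expr0n /= sqr_ge0.
case: ifPn => [|_]; last by rewrite expr0n /= sqr_ge0.
rewrite inE => /bb/andP[b1 b2].
have c0 : 0 <= cbeta P (spt s t) by rewrite (le_trans _ b1) // ltW.
have kP : 0 <= kk P by exact: ltW.
rewrite lerXn2r ?nnegrE ?mulr_ge0 // ?(le_trans c0) //.
by rewrite ler_wpM2l.
Qed.

Definition side_form u v (s : side R) : R[i] :=
  wform lebesgue_measure (I01 R) (fun t => 0 +i* impedance (spt s t))
    (fun t => tr u (spt s t)) (fun t => tr v (spt s t)).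

Lemma sint_side_form u v (s : side R) :
  sint s (fun x => if x \in (GammaN P `|` GammaR P) `&` bd O
      then Tk P (tr u) x * Num.conj (tr v x) else 0) =
  (Defs.edist s.1 s.2)%:C * side_form u v s.
Proof.
set F := fun x => _.
have FE t : F (spt s t) = (0 +i* impedance (spt s t)) * tr u (spt s t)
    * conjc (tr v (spt s t)).
  rewrite /F /impedance /Tk; case: ifP => _; last by rewrite !mul0r.
  by case: ifP => _ //; rewrite !mul0r.
have scale (r a b : R) : (r * a) +i* (r * b) = r%:C * (a +i* b).
  by apply/eqP; rewrite eq_complex /= !mul0r subr0 addr0 !eqxx.
rewrite /sint scale; congr (_ * _); rewrite /side_form /wform /gint.
by congr (_ +i* _); apply: eq_Rintegral => t _; rewrite FE.
Qed.

Lemma aformE u v : aform P O u v =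
  wform area O weightA (dx u) (dx v) + wform area O weightA (dy u) (dy v)
  - (kk P ^+ 2)%:C * wform area O weightV (fn u) (fn v)
  - \sum_(s <- bsides P) (Defs.edist s.1 s.2)%:C * side_form u v s.
Proof.
by congr (_ - _); apply: eq_bigr => s _; exact: sint_side_form.
Qed.

Lemma aformD u u' v : L2 u -> L2 u' -> L2 v ->
  aform P O (sobD u u') v = aform P O u v + aform P O u' v.
Proof.
move=> hu hu' hv; rewrite !aformE.
have mO := measurable_dom.
have [mA bA] := weightA_ok; have [mV bV] := weightV_ok.
have -> : \sum_(s <- bsides P) (Defs.edist s.1 s.2)%:C * side_form (sobD u u') v s =
    \sum_(s <- bsides P) (Defs.edist s.1 s.2)%:C * side_form u v s
    + \sum_(s <- bsides P) (Defs.edist s.1 s.2)%:C * side_form u' v s.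
  rewrite -big_split /=; apply: eq_big_seq => s hs; rewrite -mulrDr; congr (_ * _).
  have [mI bI] := weightI_ok s.
  exact: (wformDl (mu := lebesgue_measure) (measurable_itv _) mI bI
    (sqint_tr hu hs) (sqint_tr hu' hs) (sqint_tr hv hs)).
rewrite (wformDl (mu := area) mO mA bA (sqint_dx hu) (sqint_dx hu') (sqint_dx hv)).
rewrite (wformDl (mu := area) mO mA bA (sqint_dy hu) (sqint_dy hu') (sqint_dy hv)).
rewrite (wformDl (mu := area) mO mV bV (sqint_fn hu) (sqint_fn hu') (sqint_fn hv)).
ring.
Qed.

Lemma aformN u v : L2 u -> L2 v ->
  aform P O (sobZ (- 1) u) v = - aform P O u v.
Proof.
move=> hu hv; rewrite !aformE.
have mO := measurable_dom.
have [mA bA] := weightA_ok; have [mV bV] := weightV_ok.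
have -> : \sum_(s <- bsides P) (Defs.edist s.1 s.2)%:C * side_form (sobZ (- 1) u) v s =
    - \sum_(s <- bsides P) (Defs.edist s.1 s.2)%:C * side_form u v s.
  rewrite -sumrN; apply: eq_big_seq => s hs; rewrite -mulrN; congr (_ * _).
  have [mI bI] := weightI_ok s.
  exact: (wformNl (mu := lebesgue_measure) (measurable_itv _) mI bI
    (sqint_tr hu hs) (sqint_tr hv hs)).
rewrite (wformNl (mu := area) mO mA bA (sqint_dx hu) (sqint_dx hv)).
rewrite (wformNl (mu := area) mO mA bA (sqint_dy hu) (sqint_dy hv)).
rewrite (wformNl (mu := area) mO mV bV (sqint_fn hu) (sqint_fn hv)).
ring.
Qed.

Lemma aformB u u' v : L2 u -> L2 u' -> L2 v ->
  aform P O (sobB u u') v = aform P O u v - aform P O u' v.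
Proof.
move=> hu hu' hv; rewrite /sobB aformD ?aformN //.
exact: sobL2N.
Qed.

Lemma eq_aform u u' v : L2 u -> L2 u' -> L2 v -> sob_eq P O u u' ->
  aform P O u v = aform P O u' v.
Proof.
move=> hu hu' hv [eO eS]; rewrite !aformE.
have mO := measurable_dom.
have [mA bA] := weightA_ok; have [mV bV] := weightV_ok.
have -> : \sum_(s <- bsides P) (Defs.edist s.1 s.2)%:C * side_form u v s =
    \sum_(s <- bsides P) (Defs.edist s.1 s.2)%:C * side_form u' v s.
  apply: eq_big_seq => s hs; congr (_ * _).
  have [mI bI] := weightI_ok s.
  apply: (eq_wform_ae (mu := lebesgue_measure) (measurable_itv _) mI
    (sqint_tr hu hs) (sqint_tr hu' hs) (sqint_tr hv hs)).
  move: hs; rewrite mem_filter => /andP[/asboolP sb sa].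
  by apply: eS => // x /sb[].
rewrite (eq_wform_ae (mu := area) mO mA
  (sqint_dx hu) (sqint_dx hu') (sqint_dx hv)); last first.
  by apply: (ae_imply (mu := area) eO) => x h /h[].
rewrite (eq_wform_ae (mu := area) mO mA
  (sqint_dy hu) (sqint_dy hu') (sqint_dy hv)); last first.
  by apply: (ae_imply (mu := area) eO) => x h /h[].
rewrite (eq_wform_ae (mu := area) mO mV (sqint_fn hu) (sqint_fn hu') (sqint_fn hv)) //.
by apply: (ae_imply (mu := area) eO) => x h /h[].
Qed.

(** The coefficients are not conjugated, so (u, v) |-> a(u, conj v) is a symmetric
    bilinear form.  Adjoint problems thereby reduce to primal ones, and
    linearity in the second argument to linearity in the first. *)
Lemma aform_sym u v : aform P O u (sobC v) = aform P O v (sobC u).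
Proof.
rewrite !aformE; congr (_ + _ - _ * _ - _).
- exact: wform_sym.
- exact: wform_sym.
- exact: wform_sym.
by apply: eq_bigr => s _; congr (_ * _); exact: wform_sym.
Qed.

Lemma aformBr u v v' : L2 u -> L2 v -> L2 v' ->
  aform P O u (sobB v v') = aform P O u v - aform P O u v'.
Proof.
have sobCK w : sobC (sobC w) = w.
  by case: w => a b c e; congr Sob; apply/funext => x; exact: conjc_conjc.
have sobCB w w' : sobC (sobB w w') = sobB (sobC w) (sobC w').
  by congr Sob; apply/funext => x /=; rewrite !mulN1c conjc_add conjc_opp.
move=> hu hv hv'; have hJ w : L2 w -> L2 (sobC w) by exact: sobL2J.
rewrite -[sobB v v']sobCK aform_sym sobCB aformB; try exact: hJ.
by rewrite aform_sym sobCK [X in _ - X]aform_sym sobCK.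
Qed.

Definition normV u : R := Num.sqrt (\int[area]_(x in O) (cV P x ^+ 2 * csq (fn u x))).

Lemma normV_sqr u : normV u ^+ 2 = \int[area]_(x in O) (cV P x ^+ 2 * csq (fn u x)).
Proof.
by rewrite sqr_sqrtr // Rintegral_ge0 // => x _; rewrite mulr_ge0 ?sqr_ge0 ?csq_ge0.
Qed.

Lemma normH_sqr u : L2 u -> normH P O u ^+ 2 =
  \int[area]_(x in O) (cA P x * csq (dx u x))
  + \int[area]_(x in O) (cA P x * csq (dy u x)) + kk P ^+ 2 * normV u ^+ 2.
Proof.
move=> hu; have mO := measurable_dom.
have [_ _ _ [mA mV _] [[_ A0 _ V0] [bA _ bV]]] := hP.
have A_ge0 x : O x -> 0 <= cA P x.
  by move=> /bA/andP[h _]; rewrite (le_trans _ h) // ltW.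
have bA' x : O x -> `|cA P x| <= Amax P.
  by move=> Ox; rewrite ger0_norm ?A_ge0 //; have /andP[] := bA x Ox.
have V_ge0 x : O x -> 0 <= cV P x.
  by move=> /bV/andP[h _]; rewrite (le_trans _ h) // ltW.
have bV' x : O x -> `|cV P x ^+ 2| <= Vmax P ^+ 2.
  move=> Ox; have /andP[h1 h2] := bV x Ox.
  by rewrite ger0_norm ?sqr_ge0 // lerXn2r ?nnegrE ?(le_trans (V_ge0 x Ox) h2) ?V_ge0.
have i1 := integrable_wcsq (mu := area) mO mA bA' (sqint_dx hu).
have i2 := integrable_wcsq (mu := area) mO mA bA' (sqint_dy hu).
have mV2 : measurable_fun O (fun x => cV P x ^+ 2) by exact: measurable_funX.
have i3 := integrable_wcsq (mu := area) mO mV2 bV' (sqint_fn hu).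
rewrite normV_sqr sqr_sqrtr; last first.
  apply: Rintegral_ge0 => x Ox; apply: addr_ge0.
    by apply: mulr_ge0; [exact: A_ge0|apply: addr_ge0; exact: csq_ge0].
  by apply: mulr_ge0; [apply: mulr_ge0; exact: sqr_ge0|exact: csq_ge0].
rewrite -(Rintegral_lin3 (mu := area) mO (kk P ^+ 2) i1 i2 i3).
by apply: (eq_Rintegral area) => x _; rewrite mulrDr mulrA.
Qed.

(** Garding's identity: the domain terms differ from the energy by the sign of
    the mass term, and the impedance term is imaginary. *)
Lemma Re_aform_diag u : L2 u ->
  complex.Re (aform P O u u) = normH P O u ^+ 2 - 2 * kk P ^+ 2 * normV u ^+ 2.
Proof.
move=> hu; rewrite aformE normH_sqr // normV_sqr.
rewrite Re_cadd Re_copp Re_cadd Re_copp Re_cadd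
  (Re_wform_real area) (Re_wform_real area).
have -> : complex.Re ((kk P ^+ 2)%:C * wform area O weightV (fn u) (fn u)) =
    kk P ^+ 2 * \int[area]_(x in O) (cV P x ^+ 2 * csq (fn u x)).
  by rewrite Re_cmul /= mul0r subr0; congr (_ * _); exact: (Re_wform_real area).
have -> : complex.Re
    (\sum_(s <- bsides P) (Defs.edist s.1 s.2)%:C * side_form u u s) = 0.
  elim/big_ind : _ => // [x y hx hy|s _]; first by rewrite Re_cadd hx hy addr0.
  have e : complex.Re (side_form u u s) = 0.
    exact: (Re_wform_imaginary lebesgue_measure).
  by rewrite Re_cmul e mulr0 mul0r subr0.
ring.
Qed.

Lemma normHJ u : normH P O (sobC u) = normH P O u.
Proof.
by congr Num.sqrt; apply: eq_Rintegral => x _ /=; rewrite !csqJ.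
Qed.

End Helmholtz.
(** * The load of the dual problem *)

Section Duality.
Variables (R : realType) (P : problem R).
Hypothesis hP : helmholtz_data P.
Implicit Types u v e : sob R.

Local Notation O := (dom P).
Local Notation L2 := (sobL2 (dom P) (all_sides P)).

(** The conjugate of the solution with this load solves the adjoint problem with
    the load V^2 e. *)
Definition dual_load e (x : R * R) : R[i] := conjc ((cV P x ^+ 2)%:C * fn e x).

Lemma inL2_dual_load e : L2 e -> inL2 O (dual_load e).
Proof.
move=> he; have [mV bV] := weightV_ok hP.
exact: (sqintJ (mu := area)
  (sqintM (mu := area) (measurable_dom hP) mV bV (sqint_fn he))).
Qed.

Lemma Re_inner_dual_load e :
  complex.Re (inner O (dual_load e) (fn (sobC e))) = normV P e ^+ 2.
Proof.
rewrite normV_sqr /inner /cint /=; apply: (eq_Rintegral area) => x _.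
by rewrite /dual_load /csq; case: (fn e x) => a b /=; ring.
Qed.

Lemma Vmax_gt0 : 0 < Vmax P.
Proof.
have [[_ [x Ox] _ _] _ _ _ [[_ _ _ V0] [_ _ bV]]] := hP.
by have /andP[h1 h2] := bV x Ox; exact: lt_le_trans V0 (le_trans h1 h2).
Qed.

Lemma normL2_dual_load e : L2 e -> normL2 O (dual_load e) <= Vmax P * normV P e.
Proof.
move=> he; have mO := measurable_dom hP.
have [_ _ _ [_ mV _] [[_ _ _ V0] [_ _ bV]]] := hP.
have V_ge0 x : O x -> 0 <= cV P x.
  by move=> /bV/andP[h _]; rewrite (le_trans _ h) // ltW.
have bV' x : O x -> cV P x ^+ 2 <= Vmax P ^+ 2.
  move=> Ox; have /andP[_ h2] := bV x Ox.
  by rewrite lerXn2r ?nnegrE ?V_ge0 // ltW // Vmax_gt0.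
have i1 : (area).-integrable O (EFin \o (fun x => cV P x ^+ 2 * csq (fn e x))).
  apply: (integrable_wcsq (mu := area) mO (K := Vmax P ^+ 2)).
  - exact: measurable_funX.
  - by move=> x Ox; rewrite ger0_norm ?sqr_ge0 // bV'.
  - exact: sqint_fn he.
have i2 := integrableZl (mu := area) mO (Vmax P ^+ 2) i1.
rewrite -[leRHS]ger0_norm ?mulr_ge0 ?sqrtr_ge0 ?(ltW Vmax_gt0) //.
rewrite -sqrtr_sqr ler_wsqrtr // exprMn normV_sqr -(RintegralZl (mu := area) _ mO i1).
apply: (le_Rintegral (mu := area) mO) => //.
  exact: (sqint_csq_integrable (mu := area) (inL2_dual_load he)).
move=> x Ox; rewrite /dual_load csqJ csqM {1}/csq /= expr0n addr0.
rewrite [leLHS](_ : _ = cV P x ^+ 2 * (cV P x ^+ 2 * csq (fn e x))); last by ring.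
rewrite /= ler_wpM2r ?bV' //.
by rewrite mulr_ge0 ?sqr_ge0 ?csq_ge0.
Qed.

End Duality.

(** * The Galerkin space *)

Section GalerkinSpace.
Variables (R : realType) (P : problem R) (w : side R -> nat -> plane R -> R[i]).
Variable m : nat.
Hypothesis hP : helmholtz_data P.

Lemma inVHm_inH v : inVHm P w m v -> inH P v. Proof. by case=> -[]. Qed.

(** Membership in S is stated through sums v + conj v'; with zero as one of the
    summands, S contains the coarse space and its conjugate. *)
Lemma inVHm0 : inVHm P w m (sob0 R).
Proof.
split.
  split=> [|T _ v _]; first exact: inH_sob0.
  have z D (c h : R * R -> R[i]) : inner D (fun x => c x * 0) h = 0.
    rewrite /inner /cint /Rintegral !integral0_eq // => x _;
      by rewrite mulr0 mul0r.
  have z' D (h : R * R -> R[i]) : inner D (fun=> 0) h = 0.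
    by rewrite /inner /cint /Rintegral !integral0_eq // => x _; rewrite mul0r.
  rewrite /aform /sob0 /= !z z' mulr0 addr0 subr0 sub0r; apply/eqP.
  rewrite oppr_eq0; apply/eqP; apply: big1 => s _.
  rewrite /sint /Rintegral !integral0_eq ?mulr0 // => t _;
    by case: ifP => // _; rewrite /Tk; case: ifP => _; rewrite ?mulr0 mul0r.
exists (fun=> 0), (fun _ _ => 0) => e _; apply: (aeT lebesgue_measure) => t _ /=.
by rewrite !big1 ?addr0 // => i _; rewrite mul0r.
Qed.

Lemma sobC0 : sobC (sob0 R) = sob0 R.
Proof. by congr Sob; apply/funext => x; exact: (conjc_ofreal 0). Qed.

Lemma inVHm_inS v : inVHm P w m v -> inS P w m v.
Proof.
move=> hv; exists v, (sob0 R); split=> //; first exact: inVHm0.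
by rewrite sobC0; case: v {hv} => a b c e; congr Sob; apply/funext => x;
  rewrite /= addr0.
Qed.

Lemma inVHm_conj_inS v : inVHm P w m v -> inS P w m (sobC v).
Proof.
move=> hv; exists (sob0 R), v; split=> //; first exact: inVHm0.
by congr Sob; apply/funext => x; rewrite /= add0r.
Qed.

Lemma inS_inH v : inS P w m v -> inH P v.
Proof.
move=> [v1 [v2 [/inVHm_inH h1 /inVHm_inH h2 ->]]].
by apply: (inHD hP) => //; exact: (inHJ hP).
Qed.

End GalerkinSpace.

(** * The error estimate *)

Lemma diam_ge0 (R : realType) (D : set (plane R)) : 0 <= diam D.
Proof.
rewrite /diam; set S := [set r | _].
have [hS|/sup_out -> //] := pselect (has_sup S).
have [[r Sr] _] := hS; have r_le := sup_upper_bound hS Sr.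
by apply: le_trans r_le; have [x [y [_ _ ->]]] := Sr; exact: sqrtr_ge0.
Qed.

(** The set under the supremum may be empty, in which case the supremum is -oo
    and its finite part is 0. *)
Lemma Cstab_ge0 (R : realType) (P : problem R) : 0 <= fine (Cstab P).
Proof.
rewrite /Cstab; set S := [set r | _].
have [[r Sr]|S0] := pselect (S !=set0); last first.
  suff -> : S = set0 by rewrite ereal_sup0.
  by apply/seteqP; split=> // r Sr; apply: S0; exists r.
apply: fine_ge0; apply: (@le_trans _ _ r); last exact: ereal_sup_ubound.
by have [g [v [_ _ _ ->]]] := Sr; rewrite lee_fin divr_ge0 // sqrtr_ge0.
Qed.

(** In the application, E = |e|_H, X = |V e|, G and F are the norms of the dual
    and the primal load, r is the rate and N the norm of the bubble parts of the
    dual solution.  The duality estimate and the smallness condition give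
    k X <= E / 4; the negative term of the energy is then at most E^2 / 8. *)
Lemma schatz_bound (R : realType) (E X k Cc Cd Cs r H Vm G F N : R) :
  0 <= E -> 0 <= X -> 0 < k -> 0 < Cc -> 0 < Vm -> 0 <= r -> 0 <= H ->
  0 <= G -> 0 <= Cd * r * F ->
  X ^+ 2 <= Cc * (Cd * r * G) * E + Cc * N * E -> N <= Cs * H * G ->
  G <= Vm * X ->
  Num.max Cd Cs * k * (r + H) <= 1 / (4 * Cc * Vm) ->
  E ^+ 2 - 2 * k ^+ 2 * X ^+ 2 <= Cc * E * (Cd * r * F) ->
  E <= 2 * Cc * Cd * r * F.
Proof.
move=> E0 X0 k0 Cc0 Vm0 r0 H0 G0 F0 hX hN hG hs hE.
set M := Num.max Cd Cs in hs.
have MCd : Cd <= M by rewrite /M le_max lexx.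
have MCs : Cs <= M by rewrite /M le_max lexx orbT.
have hs' : Cc * Vm * (M * k * (r + H)) <= 4^-1.
  apply: (@le_trans _ _ (Cc * Vm * (1 / (4 * Cc * Vm)))).
    by rewrite ler_wpM2l // mulr_ge0 // ltW.
  suff -> : Cc * Vm * (1 / (4 * Cc * Vm)) = 4^-1 by [].
  by field; rewrite !gt_eqF.
have a1 : Cd * r * G + N <= M * (r + H) * G.
  have : Cd * r * G <= M * r * G by rewrite !ler_wpM2r.
  have : Cs * H * G <= M * H * G by rewrite !ler_wpM2r.
  lra.
have a2 : X ^+ 2 <= Cc * (M * (r + H) * G) * E.
  apply: (le_trans hX); rewrite -mulrDl -mulrDr ler_wpM2r // ler_wpM2l //.
  exact: ltW.
have kX : k * X <= E / 4.
  have [->|Xn0] := eqVneq X 0; first by rewrite mulr0 divr_ge0.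
  have Xp : 0 < X by rewrite lt0r Xn0.
  (* The bound on G may be inserted if its factor M (r + H) is nonnegative;
     otherwise the estimate for X ^+ 2 forces X = 0. *)
  have [Mn|Mp] := leP (M * (r + H)) 0.
    have : X ^+ 2 <= 0.
      apply: le_trans a2 _; rewrite mulr_le0_ge0 // mulr_ge0_le0 ?(ltW Cc0) //.
      by rewrite mulr_le0_ge0.
    by rewrite leNgt exprn_gt0.
  have a3 : X ^+ 2 <= Cc * (M * (r + H) * (Vm * X)) * E.
    apply: (le_trans a2); rewrite ler_wpM2r // ler_wpM2l ?(ltW Cc0) //.
    by rewrite ler_wpM2l // ltW.
  have a4 : k * X ^+ 2 <= 4^-1 * (X * E).
    apply: (@le_trans _ _ (k * (Cc * (M * (r + H) * (Vm * X)) * E))).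
      by rewrite ler_wpM2l // ltW.
    have -> : k * (Cc * (M * (r + H) * (Vm * X)) * E) =
       Cc * Vm * (M * k * (r + H)) * (X * E) by ring.
    by rewrite ler_wpM2r // mulr_ge0.
  rewrite -(ler_pM2r Xp); apply: le_trans (le_trans a4 _); first by rewrite expr2 mulrA.
  by rewrite le_eqVlt; apply/orP; left; apply/eqP; ring.
have kX2 : k ^+ 2 * X ^+ 2 <= E ^+ 2 / 16.
  rewrite -exprMn.
  have : (k * X) ^+ 2 <= (E / 4) ^+ 2.
    by rewrite lerXn2r ?nnegrE ?mulr_ge0 ?(ltW k0) ?divr_ge0.
  lra.
have [E00|En0] := eqVneq E 0.
  by rewrite E00; have := mulr_ge0 (ltW Cc0) F0; lra.
have Ep : 0 < E by rewrite lt0r En0.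
have B0 := mulr_ge0 (ltW Cc0) F0.
have : 7 / 8 * E <= Cc * (Cd * r * F).
  by rewrite -(ler_pM2r Ep); lra.
lra.
Qed.
Theorem theorem4p4 (R : realType) (P : problem R) (c0 c1 H CP CP' : R)
    (hP : helmholtz_data P)
    (hmesh : mesh_hyp P c0 c1 H)
    (hCP : forall T, T \in mesh P -> poincare P H (elt T) CP)
    (hCP' : forall e : side R,
       e \in edges P -> poincare P H (edge_patch P e) CP')
    (hCPCP' : CP <= CP')
    (hstab : stability P)
    (hH : H <= Num.sqrt (Amin P) / (Num.sqrt 2 * CP' * Vmax P * kk P))
    (u uh ub us : (plane R -> R[i]) -> sob R)
    (hdec : forall g, inL2 (dom P) g ->
       decomposition P g (u g) (uh g) (ub g) (us g))
    (sg : side R -> nat -> R) (w : side R -> nat -> plane R -> R[i])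
    (hw : forall e : side R, e \in edges P -> singular_system P e (sg e) (w e))
    (Cc Cs : R)
    (hCc : continuity_const P Cc)
    (hCs : bubble_const P H ub us Cs)
    (eps : R) (heps : 0 < eps)
    (Cd : R) (hCd : approx_const P H eps w uh us Cd)
    (m : nat)
    (hsmall : Num.max Cd Cs * kk P * (approx_rate P H eps m + H)
                <= 1 / (4 * Cc * Vmax P))
    (f : plane R -> R[i]) (hf : inL2 (dom P) f)
    (uS : sob R) (huS : inS P w m uS)
    (hRG : forall v, inS P w m v ->
       aform P (dom P) uS v =
         inner (dom P) f (fn v) - aform P (dom P) (sobD (ub f) (us f)) v) :
  normH P (dom P) (sobB (sobB (uh f) (us f)) uS)
    <= 2 * Cc * Cd * approx_rate P H eps m * normL2 (dom P) f.
Proof.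
have hL v : inH P v -> sobL2 (dom P) (all_sides P) v by exact: inH_sobL2.
have H0 : 0 <= H.
  by have [_ _ _ [_ [T _ <-] _ _] _] := hmesh; exact: diam_ge0.
set r := approx_rate P H eps m in hsmall *.
have r0 : 0 <= r.
  by rewrite mulr_ge0 ?expR_ge0 // addr_ge0 // Cstab_ge0.
have [Cc0 hC] := hCc.
have k0 : 0 < kk P by have [_ _ _ _ [[]]] := hP.
have [[hu eqf] [[huh _] hub] hsplit _ [[hus _] _]] := hdec _ hf.
set e := sobB (sobB (uh f) (us f)) uS.
have heS : inH P uS by exact: inS_inH huS.
have hus' := inHB hP huh hus.
have he : inH P e by exact: inHB.
(* As u = uh + ub solves the problem, the data and the bubble parts cancel in
   the Galerkin equation. *)
have orth v : inS P w m v -> aform P (dom P) e v = 0.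
  move=> hv; have hvH := inS_inH hP hv; have Lv := hL _ hvH.
  rewrite /e (aformB hP (hL _ hus') (hL _ heS) Lv).
  rewrite (aformB hP (hL _ huh) (hL _ hus) Lv).
  rewrite hRG // (aformD hP (hL _ hub) (hL _ hus) Lv) -(eqf _ hvH).
  rewrite (eq_aform hP (hL _ hu) (hL _ (inHD hP huh hub)) Lv hsplit).
  rewrite (aformD hP (hL _ huh) (hL _ hub) Lv); ring.
pose g := dual_load P e.
have hg : inL2 (dom P) g by exact: inL2_dual_load (hL _ he).
have [[hn eqg] [[hnh _] hnb] nsplit _ [[hns _] _]] := hdec _ hg.
have [z hz hzle] := hCd m g hg.
have hzH := inVHm_inH hz.
have heJ := inHJ hP he; have LJ := hL _ heJ.
(* The part z of the dual solution is invisible to e: by symmetry it is tested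
   as a(e, conj z). *)
have dualE : aform P (dom P) (u g) (sobC e) =
    aform P (dom P) (sobB (sobB (uh g) (us g)) z) (sobC e)
    + aform P (dom P) (us g) (sobC e) + aform P (dom P) (ub g) (sobC e).
  rewrite (eq_aform hP (hL _ hn) (hL _ (inHD hP hnh hnb)) LJ nsplit).
  rewrite (aformD hP (hL _ hnh) (hL _ hnb) LJ).
  rewrite (aformB hP (hL _ (inHB hP hnh hns)) (hL _ hzH) LJ).
  rewrite (aformB hP (hL _ hnh) (hL _ hns) LJ).
  have -> : aform P (dom P) z (sobC e) = 0.
    by rewrite aform_sym; apply: orth; exact: inVHm_conj_inS.
  ring.
have ReC a b : inH P a -> inH P b -> complex.Re (aform P (dom P) a b) <=
    Cc * normH P (dom P) a * normH P (dom P) b.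
  by move=> ha hb; exact: le_trans (Re_le_cabs _) (hC _ _ ha hb).
have X2 : normV P e ^+ 2 <= Cc * (Cd * r * normL2 (dom P) g) * normH P (dom P) e
    + Cc * (normH P (dom P) (us g) + normH P (dom P) (ub g)) * normH P (dom P) e.
  rewrite -Re_inner_dual_load -(eqg _ heJ) dualE 2!Re_cadd -addrA.
  rewrite -(normHJ P e); apply: lerD.
    apply: (le_trans (ReC _ _ (inHB hP (inHB hP hnh hns) hzH) heJ)).
    by rewrite ler_wpM2r ?sqrtr_ge0 // ler_wpM2l ?(ltW Cc0).
  by rewrite mulrDr mulrDl; apply: lerD; exact: ReC.
have [y hy hyle] := hCd m f hf.
have hyH := inVHm_inH hy.
(* Both y and uS lie in S, so uS may be replaced by y in the second argument. *)
have energy : normH P (dom P) e ^+ 2 - 2 * kk P ^+ 2 * normV P e ^+ 2 <=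
    Cc * normH P (dom P) e * (Cd * r * normL2 (dom P) f).
  rewrite -(Re_aform_diag hP (hL _ he)).
  have -> : aform P (dom P) e e =
      aform P (dom P) e (sobB (sobB (uh f) (us f)) y).
    rewrite {2}/e (aformBr hP (hL _ he) (hL _ hus') (hL _ heS)).
    rewrite (aformBr hP (hL _ he) (hL _ hus') (hL _ hyH)).
    by rewrite (orth _ huS) (orth _ (inVHm_inS hy)).
  apply: (le_trans (ReC _ _ he (inHB hP hus' hyH))).
  by rewrite ler_wpM2l // mulr_ge0 ?sqrtr_ge0 // ltW.
apply: (schatz_bound (X := normV P e) (k := kk P) (Cs := Cs) (H := H)
  (Vm := Vmax P) (G := normL2 (dom P) g)
  (N := normH P (dom P) (us g) + normH P (dom P) (ub g))) => //;
  try exact: sqrtr_ge0.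
- exact: Vmax_gt0.
- by apply: le_trans hyle; exact: sqrtr_ge0.
- exact: hCs.
- exact: normL2_dual_load (hL _ he).
Qed.
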